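(* Let $m,\ell$ be nonzero integers with $m\neq\ell$. For every element $g\in BS(m,\ell)$, either $\operatorname{scl}(g)=0$ or $\operatorname{scl}(g)\geq 1/12$.
   Context: $BS(m,\ell)=\langle a,t\mid t a^m t^{-1}=a^{\ell}\rangle$. Stable commutator length in a group $G$: for $g\in[G,G]$, $\operatorname{scl}(g)=\lim_{n\to\infty}\operatorname{cl}(g^n)/n$, where $\operatorname{cl}$ is the least number of commutators whose product is the given element; if $g^k\in[G,G]$ for some $k\ge1$, $\operatorname{scl}(g)=\operatorname{scl}(g^k)/k$; otherwise $\operatorname{scl}(g)=\infty$. *)

(* Defs.v *)
From HB Require Import structures.
From mathcomp Require Import all_boot all_order all_algebra generic_quotient.
From mathcomp Require Import all_classical all_reals all_analysis.
Set Implicit Arguments.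
Unset Strict Implicit.
Unset Printing Implicit Defensive.
Import Order.TTheory GRing.Theory Num.Theory.
Import numFieldNormedType.Exports.

Local Open Scope classical_set_scope.
Local Open Scope group_scope.
Local Open Scope quotient_scope.

(* Words over the alphabet X and formal inverses: (x, false) stands for x and
   (x, true) for x^-1. *)
Definition word (X : Type) := seq (X * bool).

Definition winv (X : Type) (w : word X) : word X :=
  rev [seq (p.1, ~~ p.2) | p <- w].

Definition wpow (X : Type) (x : X) (k : int) : word X :=
  match k with
  | Posz n => nseq n (x, false)
  | Negz n => nseq n.+1 (x, true)
  end.

(* The congruence on words presenting < X | u = v for (u, v) in rels >. *)
Inductive pres_eq (X : Type) (rels : word X -> word X -> Prop) :
    word X -> word X -> Prop :=
| pres_refl w : pres_eq rels w w
| pres_sym w1 w2 : pres_eq rels w1 w2 -> pres_eq rels w2 w1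
| pres_trans w2 w1 w3 :
    pres_eq rels w1 w2 -> pres_eq rels w2 w3 -> pres_eq rels w1 w3
| pres_cancel w1 w2 x b :
    pres_eq rels (w1 ++ [:: (x, b); (x, ~~ b)] ++ w2) (w1 ++ w2)
| pres_rel w1 w2 u v : rels u v -> pres_eq rels (w1 ++ u ++ w2) (w1 ++ v ++ w2).

Section PresEqTheory.
Variables (X : Type) (rels : word X -> word X -> Prop).
Local Notation "u ~ v" := (pres_eq rels u v) (at level 70).

Lemma pres_ctx w1 w2 u v : u ~ v -> w1 ++ u ++ w2 ~ w1 ++ v ++ w2.
Proof.
elim=> {u v} [w|u v _|v u w _ uv _ vw|a b x e|a b u v uv].
- exact: pres_refl.
- exact: pres_sym.
- exact: pres_trans uv vw.
- by have := pres_cancel rels (w1 ++ a) (b ++ w2) x e; rewrite -!catA.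
- by have := pres_rel (w1 ++ a) (b ++ w2) uv; rewrite -!catA.
Qed.

Lemma pres_cat u u' v v' : u ~ u' -> v ~ v' -> u ++ v ~ u' ++ v'.
Proof.
move=> uu' vv'; apply: (pres_trans (w2 := u' ++ v)).
  by have := pres_ctx [::] v uu'.
by have := pres_ctx u' [::] vv'; rewrite !cats0.
Qed.

Lemma winvK : involutive (@winv X).
Proof.
move=> w; rewrite /winv map_rev revK -map_comp -[RHS]map_id.
by apply: eq_map => -[x b] /=; rewrite negbK.
Qed.

Lemma pres_mulV w : w ++ winv w ~ [::].
Proof.
elim: w => [|[x b] w IHw]; first exact: pres_refl.
rewrite /winv /= rev_cons -cats1.
apply: (pres_trans (w2 := [:: (x, b)] ++ [:: (x, ~~ b)])).
  by have := pres_ctx [:: (x, b)] [:: (x, ~~ b)] IHw; rewrite -!catA.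
by have := pres_cancel rels [::] [::] x b; rewrite !cats0.
Qed.

Lemma pres_Vmul w : winv w ++ w ~ [::].
Proof. by have := pres_mulV (winv w); rewrite winvK. Qed.

Lemma pres_winv u v : u ~ v -> winv u ~ winv v.
Proof.
move=> uv; apply: (pres_trans (w2 := winv u ++ v ++ winv v)).
  rewrite -[X in pres_eq _ X _]cats0.
  exact/pres_cat/pres_sym/pres_mulV/pres_refl.
apply: (pres_trans (w2 := winv u ++ u ++ winv v)).
  exact/pres_ctx/pres_sym.
by rewrite catA; apply: pres_cat (pres_Vmul u) (pres_refl _ _).
Qed.

End PresEqTheory.

Section Presentation.
Variables (X : choiceType) (rels : word X -> word X -> Prop).

Definition pres_eqb : rel (word X) := fun u v => `[< pres_eq rels u v >].

Lemma pres_eqb_refl : reflexive pres_eqb.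
Proof. by move=> u; apply/asboolP; apply: pres_refl. Qed.

Lemma pres_eqb_sym : symmetric pres_eqb.
Proof. by move=> u v; apply/asboolP/asboolP => /pres_sym. Qed.

Lemma pres_eqb_trans : transitive pres_eqb.
Proof.
by move=> v u w /asboolP uv /asboolP vw; apply/asboolP/(pres_trans uv vw).
Qed.

Canonical pres_equiv : equiv_rel (word X) :=
  EquivRel pres_eqb pres_eqb_refl pres_eqb_sym pres_eqb_trans.

Definition presented := {eq_quot pres_equiv}.

HB.instance Definition _ := Choice.on presented.
HB.instance Definition _ := EqQuotient.on presented.

Definition pres_class (w : word X) : presented := \pi_presented%qT w.

Lemma pres_classP u v : pres_class u = pres_class v <-> pres_eq rels u v.
Proof.
split=> [uv|uv].
  by apply/asboolP; move/eqP: uv; rewrite eqmodE.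
by apply/eqP; rewrite eqmodE; apply/asboolP.
Qed.

Lemma pres_classK (p : presented) : pres_class (repr p) = p.
Proof. exact: reprK. Qed.

Definition pres_mul (p q : presented) : presented :=
  pres_class (repr p ++ repr q).
Definition pres_one : presented := pres_class [::].
Definition pres_inv (p : presented) : presented := pres_class (winv (repr p)).

Lemma pres_mulE u v :
  pres_mul (pres_class u) (pres_class v) = pres_class (u ++ v).
Proof.
by apply/pres_classP/pres_cat; apply/pres_classP; rewrite pres_classK.
Qed.

Lemma pres_invE u : pres_inv (pres_class u) = pres_class (winv u).
Proof.
by apply/pres_classP/pres_winv; apply/pres_classP; rewrite pres_classK.
Qed.

Lemma pres_mulA : associative pres_mul.
Proof.
move=> p q r; rewrite -(pres_classK p) -(pres_classK q) -(pres_classK r).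
by rewrite !pres_mulE catA.
Qed.

Lemma pres_mul1 : left_id pres_one pres_mul.
Proof. by move=> p; rewrite -(pres_classK p) pres_mulE. Qed.

Lemma pres_mulr1 : right_id pres_one pres_mul.
Proof. by move=> p; rewrite -(pres_classK p) pres_mulE cats0. Qed.

Lemma pres_mulVg : left_inverse pres_one pres_inv pres_mul.
Proof.
move=> p; rewrite -(pres_classK p) pres_invE pres_mulE.
exact/pres_classP/pres_Vmul.
Qed.

Lemma pres_mulgV : right_inverse pres_one pres_inv pres_mul.
Proof.
move=> p; rewrite -(pres_classK p) pres_invE pres_mulE.
exact/pres_classP/pres_mulV.
Qed.

HB.instance Definition _ := isGroup.Build presented
  pres_mulA pres_mul1 pres_mulr1 pres_mulVg pres_mulgV.

End Presentation.

Section BaumslagSolitar.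
Variables m l : int.

(* The two generators are the booleans. *)
Definition bs_a : bool := false.
Definition bs_t : bool := true.

Definition bs_rels (u v : word bool) : Prop :=
  u = wpow bs_t 1%R ++ wpow bs_a m ++ wpow bs_t (-1)%R /\ v = wpow bs_a l.

Definition BS := presented bs_rels.
HB.instance Definition _ := Group.on BS.

Definition BSa : BS := pres_class bs_rels (wpow bs_a 1%R).
Definition BSt : BS := pres_class bs_rels (wpow bs_t 1%R).

End BaumslagSolitar.

Definition expgz (G : groupType) (x : G) (k : int) : G :=
  match k with Posz n => x ^+ n | Negz n => x ^- n.+1 end.

Lemma pres_class_wpow (X : choiceType) (rels : word X -> word X -> Prop) x k :
  pres_class rels (wpow x k) = expgz (pres_class rels (wpow x 1%R)) k.
Proof.
have catE u v : pres_class rels (u ++ v) = pres_class rels u * pres_class rels v.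
  by rewrite -pres_mulE.
have powE b n :
    pres_class rels (nseq n (x, b)) = pres_class rels [:: (x, b)] ^+ n.
  by elim: n => // n IHn; rewrite expgS -IHn -catE.
case: k => n; first exact: powE.
rewrite [LHS]powE /= -expVgn; congr (_ ^+ _).
by apply: esym; apply: pres_invE.
Qed.

Lemma BS_relation (m l : int) :
  BSt m l * expgz (BSa m l) m * (BSt m l)^-1 = expgz (BSa m l) l.
Proof.
rewrite -!pres_class_wpow.
have -> : (BSt m l)^-1 = pres_class (bs_rels m l) (wpow bs_t (-1)%R).
  exact: pres_invE.
transitivity (pres_class (bs_rels m l)
    ((wpow bs_t 1%R ++ wpow bs_a m) ++ wpow bs_t (-1)%R)).
  by rewrite -!pres_mulE.
apply/pres_classP; rewrite -catA.
have rel_ml := conj erefl erefl : bs_rels m l _ _.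
by have := pres_rel [::] [::] rel_ml; rewrite !cats0.
Qed.

Section StableCommutatorLength.
Variables (R : realType) (G : groupType).

Definition is_subgroup (H : set G) : Prop :=
  [/\ H 1, (forall x y, H x -> H y -> H (x * y)) & (forall x, H x -> H x^-1)].

Definition commutator_subgroup : set G :=
  smallest is_subgroup [set z | exists x y : G, z = [~ x, y]].

Definition is_comm_prod (g : G) (n : nat) : Prop :=
  exists s : seq (G * G), size s = n /\ g = \prod_(p <- s) [~ p.1, p.2].

Lemma commutator_subgroupP g :
  commutator_subgroup g <-> exists n, is_comm_prod g n.
Proof.
split=> [|[n [s [_ ->]]] H [[H1 HM _] HC]]; last first.
  elim: s => [|p s IHs]; first by rewrite big_nil.
  by rewrite big_cons; apply: HM => //; apply: HC; exists p.1, p.2.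
move=> /(_ [set h | exists n, is_comm_prod h n]); apply.
split=> [|_ [x [y ->]]]; last first.
  by exists 1%N, [:: (x, y)]; rewrite big_seq1.
split=> [|x y [_ [s [_ ->]]] [_ [s' [_ ->]]]|x [_ [s [_ ->]]]].
- by exists 0%N, [::]; rewrite big_nil.
- by exists (size (s ++ s')), (s ++ s'); rewrite big_cat.
elim: s => [|p s [_ [s' [_ IHs]]]]; first by exists 0%N, [::]; rewrite !big_nil invg1.
exists (size (rcons s' (p.2, p.1))), (rcons s' (p.2, p.1)); split=> //.
by rewrite big_cons invgM IHs invgR -cats1 big_cat big_seq1.
Qed.

(* Only meaningful on the commutator subgroup; 0 elsewhere. *)
Definition cl (g : G) : nat :=
  if pselect (exists n, `[< is_comm_prod g n >]) is left ex then ex_minn ex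
  else 0%N.

(* On the commutator subgroup the sequence n |-> cl (g ^+ n) is subadditive, so
   the limit exists (Fekete). *)
Definition scl_comm (g : G) : R :=
  limn (fun n : nat => ((cl (g ^+ n)%g)%:R / n%:R)%R : R).

(* The value does not depend on which k is chosen in the second case, since
   scl_comm (g ^+ j) = j * scl_comm g on the commutator subgroup. *)
Definition scl (g : G) : \bar R :=
  if pselect (commutator_subgroup g) then (scl_comm g)%:E
  else if pselect (exists k, (0 < k)%N /\ commutator_subgroup (g ^+ k)) is left ex
  then let k := sval (cid ex) in (scl_comm (g ^+ k)%g / k%:R)%R%:E
  else +oo%E.

End StableCommutatorLength.

Arguments scl R {G} g.

(* Main.v *)
Require Import Defs.
From mathcomp Require Import all_boot all_order all_algebra.
From mathcomp Require Import all_classical all_reals all_analysis.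
From mathcomp Require Import zify ring lra.
Import Order.TTheory GRing.Theory Num.Theory.
Import numFieldNormedType.Exports.

(** Let T be the Bass-Serre tree of BS(m, l), whose vertex stabilizers are the
    conjugates of <a>.  Every element g falls into one of the following cases.

    If the t-exponent of g is nonzero, no positive power of g is a product of
    commutators and scl g is infinite.  From now on the t-exponent is 0, so that
    g preserves the height function of T.

    If g fixes a vertex, it is conjugate to a power of a.  The relation makes
    a^((m - l) k) a commutator for every k, so scl g = 0 ([scl_elliptic]).

    Otherwise g translates an axis in T, by L say ([axis_exists]).  Fix an edge e
    of the axis and let c be the path that runs from e to g e, both edges
    included.  On the group, count the copies of c in the geodesic from o to x o,
    where two consecutive copies may share one edge, minus the copies of the
    reversed path.  If edges are cut at their midpoints, c is a fundamental
    domain of the axis and disjoint copies fit once per period.  Cutting a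
    geodesic at a vertex destroys at most one copy, so a tripod of geodesics
    gives a quasimorphism of defect 3 ([walk_countM]).  If no translate of the
    reversed c lies in the axis, its value on g^n is at least n - 1.  It takes
    values at most 12 k on products of k commutators, whence cl (g^n) >= n / 12
    and scl g >= 1/12 ([well_aligned_bound]).

    It remains to treat the case in which every window [e, e + L] of the axis is
    reversed into the axis by some element h of the group.  Then some h inverts g
    up to an element of the pointwise stabilizer of the whole axis
    ([axis_inverted_of_reversals]), and this forces scl g = 0
    ([scl_inverted]), because the elements of that stabilizer commute with g and
    are conjugate to powers of a.  Two facts make this work.
    First, an elliptic element acts near its fixed vertices like a rational number
    ([rotation]), and it fixes an edge if and only if this number lies in a lattice
    that depends only on the height of the edge ([edge_lattice]).  Hence an
    element which fixes a segment of the axis containing an edge of maximal and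
    an edge of minimal level fixes the axis ([full_axis_fixer]).
    Second, a reversal of a window acts on positions as a reflection which is a
    symmetry of the level function.  Its two centres per period cut the window
    into two segments; if both contain the two kinds of extreme edges, the
    reversal and its composite with g are involutions modulo the stabilizer
    ([inverted_of_involutions]).  If one of them does not, the reflection has to
    preserve a maximal run of extreme edges of one kind, and so is determined by
    that run ([window_center]).  The opposite centre lies in a second run
    preserved by the same reflection; comparing the reversals of windows which
    start in these two runs yields an element that reverses more than a period. *)

Local Open Scope ring_scope.

Set Implicit Arguments.
Unset Strict Implicit.
Unset Printing Implicit Defensive.

(** * Commutator length and its stabilization *)

Section CommutatorLength.
Variable G : groupType.
Local Open Scope group_scope.
Implicit Types (g h x y : G) (n k : nat).

Lemma is_comm_prod_commg x y : is_comm_prod [~ x, y] 1.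
Proof. by exists [:: (x, y)]; rewrite big_seq1. Qed.

Lemma is_comm_prodM g h n k :
  is_comm_prod g n -> is_comm_prod h k -> is_comm_prod (g * h) (n + k).
Proof.
move=> [s [<- ->]] [s' [<- ->]]; exists (s ++ s').
by rewrite size_cat big_cat.
Qed.

Lemma is_comm_prodX g n k : is_comm_prod g n -> is_comm_prod (g ^+ k) (k * n).
Proof.
move=> gn; elim: k => [|k IHk]; first by exists [::]; rewrite big_nil.
by rewrite expgS mulSn; apply: is_comm_prodM.
Qed.

Lemma leq_is_comm_prod g n k : (n <= k)%N -> is_comm_prod g n -> is_comm_prod g k.
Proof.
move=> /subnKC <-; elim: (k - n)%N => [|j IHj] gn; first by rewrite addn0.
rewrite addnS -addn1 -[g]mulg1; apply: is_comm_prodM; first exact: IHj.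
by have := is_comm_prod_commg 1 1; rewrite commgg.
Qed.

Lemma is_comm_prodJ g h n : is_comm_prod g n -> is_comm_prod (g ^ h) n.
Proof.
move=> [s [<- ->]]; exists [seq (p.1 ^ h, p.2 ^ h) | p <- s].
rewrite size_map big_map conjg_prod; split=> //.
by apply: eq_bigr => p _; rewrite conjRg.
Qed.

Lemma cl_le g n : is_comm_prod g n -> (cl g <= n)%N.
Proof.
move=> gn; rewrite /cl; case: pselect => // ex.
by case: ex_minnP => j _; apply; apply/asboolP.
Qed.

Lemma cl_is_comm_prod g : commutator_subgroup g -> is_comm_prod g (cl g).
Proof.
move=> /commutator_subgroupP[n gn]; rewrite /cl; case: pselect => [ex|].
  by case: ex_minnP => j /asboolP.
by case; exists n; apply/asboolP.
Qed.

Lemma commutator_subgroupX g n :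
  commutator_subgroup g -> commutator_subgroup (g ^+ n).
Proof.
move=> /commutator_subgroupP[k gk]; apply/commutator_subgroupP.
by exists (n * k)%N; apply: is_comm_prodX.
Qed.

End CommutatorLength.

(** For u subadditive, u n / n converges to its infimum: writing n = q N + r gives
    u n / n <= u N / N + O (1 / n) for each N. *)
Lemma fekete (R : realType) (u : nat -> nat) :
  (forall m n, (u (m + n) <= u m + u n)%N) ->
  cvgn (fun n => (u n)%:R / n%:R : R).
Proof.
move=> usub.
have umul (q N : nat) : (u (q.+1 * N) <= q.+1 * u N)%N.
  elim: q => [|q IHq]; first by rewrite !mul1n.
  by rewrite mulSn (leq_trans (usub _ _)) // [leqRHS]mulSn leq_add2l.
have u_le n : (u n <= u 0 + n * u 1)%N.
  elim: n => [|n IHn]; first by rewrite leq_addr.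
  rewrite -addn1 (leq_trans (usub _ _)) // mulnDl mul1n addnA leq_add2r.
  exact: IHn.
have udiv n N : (0 < N)%N -> (u n * N <= n * u N + N * (u 0 + N * u 1))%N.
  move=> N0.
  have [nN|nN] := ltnP n N.
    rewrite mulnC (leq_trans _ (leq_addl _ _)) // leq_mul2l.
    rewrite (leq_trans (u_le n)) ?orbT // leq_add2l leq_mul2r (ltnW nN) orbT //.
  have [q qE] : exists q, (n %/ N = q.+1)%N.
    by exists (n %/ N).-1; rewrite prednK // divn_gt0.
  have nE := divn_eq n N.
  have h1 : (u n <= q.+1 * u N + (u 0 + N * u 1))%N.
    rewrite {1}nE qE (leq_trans (usub _ _)) // leq_add ?umul //.
    rewrite (leq_trans (u_le _)) // leq_add2l leq_mul2r.
    by rewrite (ltnW (ltn_pmod n N0)) orbT.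
  rewrite (leq_trans (leq_mul h1 (leqnn N))) // mulnDl [X in (_ + X)%N]mulnC.
  rewrite leq_add2r mulnAC leq_mul2r -qE -{2}[n]addn0 {2}nE addn0.
  by rewrite leq_addr orbT.
pose A : set R := [set x | exists n, x = (u n.+1)%:R / n.+1%:R]%classic.
have A0 : (A !=set0)%classic by exists ((u 1)%:R / 1); exists 0%N.
have Alb : has_lbound A by exists 0 => _ [n ->]; rewrite divr_ge0.
apply/cvg_ex; exists (inf A); apply/cvgrPdist_le => e e0.
have [_ [N' ->] uN] : exists2 x, A x & x < inf A + e / 2.
  by apply: inf_adherent => //; rewrite divr_gt0.
set N := N'.+1 in uN.
set B := (u 0 + N * u 1)%N.
near=> n.
have n0 : (0 < n)%N by near: n; exists 1%N.
have nR : 0 < n%:R :> R by rewrite ltr0n.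
have NR : 0 < N%:R :> R by rewrite ltr0n.
have lo : inf A <= (u n)%:R / n%:R.
  apply: ge_inf => //; by exists n.-1; rewrite prednK.
have hi : (u n)%:R / n%:R <= (u N)%:R / N%:R + B%:R / n%:R :> R.
  have := udiv n N isT; rewrite -/B -(ler_nat R) natrD !natrM => h.
  rewrite -(ler_pM2r nR) mulrDl !mulfVK ?gt_eqF // -(ler_pM2r NR) mulrDl.
  by apply: le_trans h _; rewrite mulrAC mulfVK ?gt_eqF // lerD // mulrC.
have Be : B%:R / n%:R <= e / 2.
  rewrite ler_pdivrMr // mulrC -ler_pdivrMr ?divr_gt0 //.
  near: n; exact: nbhs_infty_ger.
rewrite ler0_norm ?subr_le0 //; lra.
Unshelve. all: by end_near. Qed.

Section StableCommutatorLength.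
Variables (R : realType) (G : groupType).
Implicit Types g : G.

Lemma cvg_cl_pow g : commutator_subgroup g ->
  cvgn (fun n => (cl (g ^+ n)%g)%:R / n%:R : R).
Proof.
move=> gC; apply: (@fekete R (fun n => cl (g ^+ n)%g)) => m n.
apply: cl_le; rewrite expgnDr; apply: is_comm_prodM;
  by apply: cl_is_comm_prod; apply: commutator_subgroupX.
Qed.

Lemma scl_comm_eq0 g M K : (0 < M)%N -> commutator_subgroup g ->
  (forall n, is_comm_prod (g ^+ (M * n))%g K) -> scl_comm R g = 0.
Proof.
move=> M0 gC gK; rewrite /scl_comm.
set B := (K + M * cl g)%N.
have bnd n : (cl (g ^+ n)%g <= B)%N.
  apply: cl_le; rewrite (divn_eq n M) mulnC expgnDr; apply: is_comm_prodM => //.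
  apply: (@leq_is_comm_prod _ _ ((n %% M) * cl g)%N).
    by rewrite leq_mul2r (ltnW (ltn_pmod n M0)) orbT.
  exact/is_comm_prodX/cl_is_comm_prod.
apply/cvg_lim => //; apply/cvgrPdist_le => e e0; near=> n.
have n0 : (0 < n)%N by near: n; exists 1%N.
rewrite sub0r normrN ger0_norm ?divr_ge0 // ler_pdivrMr ?ltr0n // mulrC.
rewrite -ler_pdivrMr //; apply: (@le_trans _ _ (B%:R / e)).
  by rewrite ler_pM2r ?invr_gt0 // ler_nat.
near: n; exact: nbhs_infty_ger.
Unshelve. all: by end_near. Qed.

(** The hypothesis for n = 1 already puts g ^+ M in the commutator subgroup, so
    that scl is not infinite. *)
Lemma scl_eq0 g M K : (0 < M)%N ->
  (forall n, is_comm_prod (g ^+ (M * n))%g K) -> scl R g = 0%:E.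
Proof.
move=> M0 gK; rewrite /scl; case: (pselect (commutator_subgroup g)) => [gC|gNC] /=.
  by rewrite (scl_comm_eq0 M0 gC gK).
case: pselect => [ex|[]]; last first.
  exists M; split=> //; apply/commutator_subgroupP; exists K.
  by rewrite -[M]muln1.
case: (cid ex) => k [k0 gkC] /=; rewrite (@scl_comm_eq0 _ M K) ?mul0r // => n.
by rewrite -expgnA mulnC -mulnA.
Qed.

Lemma scl_comm_ge g c : commutator_subgroup g ->
  (forall n, c * n%:R <= (cl (g ^+ n)%g)%:R) -> c <= scl_comm R g.
Proof.
move=> gC gc; apply: limr_ge; first exact: cvg_cl_pow.
near=> n.
have n0 : (0 < n)%N by near: n; exists 1%N.
by rewrite ler_pdivlMr ?ltr0n.
Unshelve. all: by end_near. Qed.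

Lemma scl_ge g (N : nat) : (0 < N)%N ->
  (forall n k, is_comm_prod (g ^+ n)%g k -> (n <= N * k)%N) ->
  ((1 / N%:R)%:E <= scl R g)%E.
Proof.
move=> N0 gN.
have NR : 0 < N%:R :> R by rewrite ltr0n.
have key k n : commutator_subgroup (g ^+ k)%g ->
    k%:R / N%:R * n%:R <= (cl ((g ^+ k) ^+ n)%g)%:R :> R.
  move=> gkC; rewrite mulrAC ler_pdivrMr // -!natrM ler_nat.
  rewrite [leqRHS]mulnC; apply: gN; rewrite expgnA.
  by apply: cl_is_comm_prod; apply: commutator_subgroupX.
rewrite /scl; case: (pselect (commutator_subgroup g)) => [gC|gNC] /=.
  by rewrite lee_fin; apply: scl_comm_ge => // n; apply: (key 1%N n).
case: pselect => [ex|noex] /=; last by rewrite leey.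
case: (cid ex) => k [k0 gkC] /=; rewrite lee_fin ler_pdivlMr ?ltr0n //.
apply: scl_comm_ge => // n; rewrite mul1r [N%:R^-1 * _]mulrC.
exact: key.
Qed.

End StableCommutatorLength.

Section QuasiMorphism.
Variables (G : groupType) (f : G -> int) (D : int).
Local Open Scope group_scope.
Hypothesis fV : forall g, f g^-1 = (- f g)%R.
Hypothesis fM : forall g h, (`|f (g * h) - (f g + f h)| <= D)%R.

(** For an antisymmetric f the letters of a commutator cancel, so only the 4 k - 1
    multiplications of a product of k commutators contribute. *)
Lemma quasimorphism_comm_prod g k : is_comm_prod g k -> (`|f g| <= 4 * D * k%:Z)%R.
Proof.
have f1 : f 1 = 0%R by have := fV 1; rewrite invg1; move: (f 1) => z; lia.
have fC x y : (`|f [~ x, y]| <= 3 * D)%R.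
  rewrite /commg /conjg; have := fM x^-1 (y^-1 * (x * y)).
  have := fM y^-1 (x * y); have := fM x y; rewrite !fV.
  by move: (f _) (f _) (f _) (f _) (f _) => a b c d e; lia.
move=> [s [<- ->]]; elim: s => [|p s IHs]; first by rewrite big_nil f1 /=; lia.
rewrite big_cons /=; have := fM [~ p.1, p.2] (\prod_(q <- s) [~ q.1, q.2]).
have := fC p.1 p.2; move: IHs; set X := f [~ _, _]; set Y := f (\prod_(_ <- _) _).
by set Z := f _; lia.
Qed.

End QuasiMorphism.

(** * Reduced walks in a tree *)

Section ReducedWalks.
Variables (V : eqType) (adj : rel V).
Hypothesis adjC : symmetric adj.
Implicit Types (s p q : seq V) (x y z : V).

Fixpoint reduced s : bool :=
  if s is x :: s1 then
    if s1 is y :: s2 then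
      [&& adj x y, (if s2 is z :: _ then x != z else true) & reduced s1]
    else true
  else true.

Lemma reduced_nth_adj x0 s i : reduced s -> (i.+1 < size s)%N ->
  adj (nth x0 s i) (nth x0 s i.+1).
Proof.
elim: s i => [|x [|y s] IHs] [|i] //; first by move=> /= /and3P[].
by move=> /= /and3P[_ _ /IHs]; apply.
Qed.

Lemma reduced_nth_neq x0 s i : reduced s -> (i.+2 < size s)%N ->
  nth x0 s i != nth x0 s i.+2.
Proof.
elim: s i => [|x [|y [|z s]] IHs] [|i] //; first by move=> /= /and3P[].
by move=> /= /and3P[_ _ /IHs]; apply.
Qed.

(** Being reduced is a condition on three consecutive vertices, hence can be
    checked on two pieces that overlap in an edge. *)
Lemma reduced_cat s1 x y s2 :
  reduced (s1 ++ x :: y :: s2) = reduced (s1 ++ [:: x; y]) && reduced (x :: y :: s2).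
Proof.
elim: s1 => [|u [|w s1] IHs] /=; first by case: (adj x y).
  by rewrite andbT; case: (adj x y); rewrite ?andbF ?andbT ?andbA.
have -> : (if s1 ++ x :: y :: s2 is z :: _ then u != z else true)
        = (if s1 ++ [:: x; y] is z :: _ then u != z else true) by case: s1 {IHs}.
by rewrite [X in [&& _, _ & X]]IHs /= !andbA.
Qed.

Lemma reduced_rev s : reduced (rev s) = reduced s.
Proof.
elim: s => // x [|y [|z s]] // IHs; first by rewrite /= adjC.
rewrite 3!rev_cons -!cats1 -!catA reduced_cat /= !andbT.
rewrite !rev_cons -!cats1 -catA /= in IHs; rewrite IHs.
rewrite [adj z y]adjC [adj y x]adjC [z == x]eq_sym.
by case: (adj x y); case: (adj y z); case: (x == z); rewrite /= ?andbF ?andbT.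
Qed.

Lemma reduced_catr s1 s2 : reduced (s1 ++ s2) -> reduced s2.
Proof.
elim: s1 => // x s1 IHs /= h; apply: IHs.
by move: h; case: (s1 ++ s2) => // y s /and3P[].
Qed.

Lemma reduced_catl s1 s2 : reduced (s1 ++ s2) -> reduced s1.
Proof. by rewrite -reduced_rev rev_cat => /reduced_catr; rewrite reduced_rev. Qed.

Lemma reduced_join s1 u o w s2 :
  reduced (rcons s1 u ++ [:: o]) -> reduced (o :: w :: s2) -> u != w ->
  reduced (rcons s1 u ++ o :: w :: s2).
Proof.
rewrite -!cats1 -!catA => s1uo ow uw; rewrite reduced_cat s1uo /=.
by have /= /andP[-> _] := reduced_catr s1uo; rewrite uw.
Qed.

Hypothesis no_closed_walk : forall x p, reduced (x :: p) -> last x p = x -> p = [::].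

(** If two reduced walks with the same ends diverge, going back along one and forth
    along the other is a closed reduced walk. *)
Lemma reduced_inj x p q :
  reduced (x :: p) -> reduced (x :: q) -> last x p = last x q -> p = q.
Proof.
elim: p x q => [|y p IHp] x [|z q] //.
- by move=> _ xq /= xE; rewrite (no_closed_walk xq).
- by move=> xp _ /= xE; rewrite (no_closed_walk xp).
move=> xyp xzq /= lE; have [yz|yz] := eqVneq y z.
  rewrite -yz in xzq lE *; congr (_ :: _); apply: (IHp y) => //.
    exact: (@reduced_catr [:: x]).
  exact: (@reduced_catr [:: x]).
have : reduced (rcons (rev p) y ++ x :: z :: q).
  apply: reduced_join => //.
  by rewrite -rev_cons cats1 -rev_cons reduced_rev.
have lp := lastI y p; rewrite -rev_cons lp rev_rcons /= => /no_closed_walk.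
by rewrite last_cat /= lE => /(_ erefl)/(congr1 size); rewrite size_cat /=; lia.
Qed.

Definition diverge p q : bool :=
  if p is u :: _ then (if q is w :: _ then u != w else true) else true.

Lemma common_prefix x p q : exists a o b c,
  [/\ x :: p = a ++ o :: b, x :: q = a ++ o :: c
    & diverge b c].
Proof.
elim: p x q => [|y p IHp] x q; first by exists [::], x, [::], q.
case: q => [|z q]; first by exists [::], x, (y :: p), [::].
have [yz|yz] := eqVneq y z; last by exists [::], x, (y :: p), (z :: q).
have [a [w [b [c [pE qE bc]]]]] := IHp y q.
by exists (x :: a), w, b, c; split=> //=; rewrite ?pE // -yz qE.
Qed.

(** The third side of a geodesic triangle: two geodesics from a common origin which
    separate at o join up to a geodesic between their ends. *)
Lemma reduced_tripod a o b c : reduced (a ++ o :: b) -> reduced (a ++ o :: c) ->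
  diverge b c ->
  reduced (rev b ++ o :: c).
Proof.
move=> /reduced_catr ob /reduced_catr oc.
case: b ob => [|u b] // ob; case: c oc => [|w c] oc uw.
  by rewrite cats1 -rev_cons reduced_rev.
by rewrite rev_cons; apply: reduced_join => //; rewrite -rev_cons cats1 -rev_cons reduced_rev.
Qed.

End ReducedWalks.

(** * Counting disjoint copies of a path *)

Section Counting.
Local Open Scope nat_scope.
Variables (G : groupType) (V : eqType) (act : G -> V -> V).
Hypothesis actM : forall g h v, act (g * h)%g v = act g (act h v).
Hypothesis act1 : forall v, act 1%g v = v.
Implicit Types (c s : seq V) (A : seq nat).

Definition copy_at c s i : Prop :=
  exists h, [seq act h v | v <- c] = take (size c) (drop i s).

(** Copies of c are given by their starting positions.  The bound j + 2 allows
    consecutive copies to share two vertices, that is one edge. *)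
Definition packing c s A : Prop :=
  [/\ uniq A, forall i, i \in A -> copy_at c s i
    & forall i j, i \in A -> j \in A -> i < j -> i + size c <= j + 2].

Definition packable c s k : Prop := exists2 A, size A = k & packing c s A.

Definition count_copies c s : nat :=
  \max_(k < (size s).+1 | `[< packable c s k >]) k.

Lemma copy_at_size c s i : 0 < size c -> copy_at c s i -> i + size c <= size s.
Proof.
move=> c0 [h /(congr1 size)]; rewrite size_map size_take size_drop.
by case: ltnP; lia.
Qed.

Lemma packing_size c s A : 0 < size c -> packing c s A -> size A <= size s.
Proof.
move=> c0 [Au Ac _]; rewrite -[leqRHS](size_iota 0); apply: uniq_leq_size => //.
by move=> i /Ac/(copy_at_size c0); rewrite mem_iota; lia.
Qed.

Lemma count_copies_ge c s k : 0 < size c -> packable c s k ->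
  k <= count_copies c s.
Proof.
move=> c0 ck; have ks : k < (size s).+1.
  by rewrite ltnS; case: ck => A <- /(packing_size c0).
apply: (@leq_bigmax_cond _ _ (fun k : 'I__ => k : nat) (Ordinal ks)).
exact/asboolP.
Qed.

Lemma count_copiesP c s : packable c s (count_copies c s).
Proof.
apply: (big_ind (packable c s)) => [|k j kP jP|i /asboolP//].
  by exists [::].
by rewrite /maxn; case: ifP.
Qed.

Lemma count_copies_map c s g :
  count_copies c [seq act g v | v <- s] = count_copies c s.
Proof.
rewrite /count_copies size_map; apply: eq_bigl => k; apply/asboolP/asboolP.
  move=> [A Ak [Au Ac As]]; exists A => //; split=> // i /Ac[h hE].
  exists (g^-1 * h)%g; under eq_map do rewrite actM; rewrite map_comp hE.
  rewrite map_take map_drop -map_comp (eq_map (g := id)) ?map_id // => v /=.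
  by rewrite -actM mulVg act1.
move=> [A Ak [Au Ac As]]; exists A => //; split=> // i /Ac[h hE].
exists (g * h)%g; under eq_map do rewrite actM.
by rewrite map_comp hE map_take map_drop.
Qed.

Lemma count_copies_rev_le c s : 0 < size c ->
  count_copies c s <= count_copies (rev c) (rev s).
Proof.
move=> c0; have [A Ak [Au Ac As]] := count_copiesP c s.
have Asz i : i \in A -> i + size c <= size s.
  by move=> /Ac/(copy_at_size c0).
apply: count_copies_ge; first by rewrite size_rev.
exists [seq size s - (i + size c) | i <- A]; first by rewrite size_map.
split.
- rewrite map_inj_in_uniq // => i j /Asz iA /Asz jA; lia.
- move=> _ /mapP[i iA ->]; have [h hE] := Ac i iA; exists h.
  have iz := Asz i iA; rewrite map_rev hE size_rev drop_rev subKn //.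
  by rewrite take_rev size_takel // addnK take_drop addnC.
move=> _ _ /mapP[i iA ->] /mapP[j jA ->]; rewrite size_rev.
have := Asz i iA; have := Asz j jA; case: (ltngtP i j) => [ij|ji|->].
- have := As i j iA jA ij; lia.
- have := As j i jA iA ji; lia.
- lia.
Qed.

Lemma count_copies_rev c s : 0 < size c ->
  count_copies (rev c) (rev s) = count_copies c s.
Proof.
move=> c0; apply/eqP; rewrite eqn_leq count_copies_rev_le // andbT.
by rewrite -{2}[c]revK -{2}[s]revK count_copies_rev_le // size_rev.
Qed.

Lemma copy_at_catl c s1 s2 i : i + size c <= size s1 ->
  copy_at c (s1 ++ s2) i <-> copy_at c s1 i.
Proof.
by move=> ic; rewrite /copy_at !take_drop takel_cat // addnC.
Qed.

Lemma copy_at_catr c s1 s2 i :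
  copy_at c (s1 ++ s2) (size s1 + i) <-> copy_at c s2 i.
Proof. by rewrite /copy_at drop_cat ltnNge leq_addr /= addKn. Qed.

Lemma count_copies_super c s1 o s2 : 2 < size c ->
  count_copies c (rcons s1 o) + count_copies c (o :: s2)
  <= count_copies c (s1 ++ o :: s2).
Proof.
move=> c2; have c0 : 0 < size c by lia.
have [A1 <- [u1 c1 sp1]] := count_copiesP c (rcons s1 o).
have [A2 <- [u2 c2' sp2]] := count_copiesP c (o :: s2).
have b1 i : i \in A1 -> i + size c <= (size s1).+1.
  by move=> /c1/(copy_at_size c0); rewrite size_rcons.
apply: count_copies_ge => //.
exists (A1 ++ [seq size s1 + i | i <- A2]); first by rewrite size_cat size_map.
split.
- rewrite cat_uniq u1 map_inj_uniq ?u2 ?andbT; last exact: addnI.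
  apply/hasPn => _ /mapP[i iA ->]; apply/negP => /b1; lia.
- move=> i; rewrite mem_cat => /orP[iA|/mapP[j jA ->]].
    rewrite -cat_rcons; apply/copy_at_catl; last exact: c1.
    by rewrite size_rcons b1.
  exact/copy_at_catr/c2'.
move=> i j; rewrite !mem_cat => /orP[iA|/mapP[i' iA ->]] /orP[jA|/mapP[j' jA ->]].
- exact: sp1.
- by move: (b1 _ iA); lia.
- by move: (b1 _ jA); lia.
by move=> ij; have := sp2 _ _ iA jA; lia.
Qed.

Lemma uniq_le1 (T : eqType) (s : seq T) :
  uniq s -> (forall x y, x \in s -> y \in s -> x = y) -> size s <= 1.
Proof.
case: s => [|x [|y s]] //= /andP[+ _] h.
by rewrite (h x y) ?inE ?eqxx ?orbT.
Qed.

(** At most one copy of a packing has the vertex o in its interior, if copies are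
    cut at the midpoints of their end edges. *)
Lemma count_copies_sub c s1 o s2 : 2 < size c ->
  count_copies c (s1 ++ o :: s2)
  <= count_copies c (rcons s1 o) + count_copies c (o :: s2) + 1.
Proof.
move=> c2; have c0 : 0 < size c by lia.
have [A <- [Au Ac As]] := count_copiesP c (s1 ++ o :: s2).
pose P1 i := i + size c <= (size s1).+1.
pose P2 i := size s1 <= i.
rewrite -(count_predC P1) -size_filter -addnA leq_add //.
  apply: count_copies_ge => //; exists [seq i <- A | P1 i] => //; split.
  - by rewrite filter_uniq.
  - move=> i; rewrite mem_filter => /andP[iP /Ac]; rewrite -cat_rcons.
    by move=> /copy_at_catl; apply; rewrite size_rcons.
  - move=> i j; rewrite !mem_filter => /andP[_ iA] /andP[_ jA]; exact: As.
rewrite -size_filter; set B := [seq _ <- A | _].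
rewrite -(count_predC P2) -!size_filter leq_add //.
  apply: count_copies_ge => //.
  exists [seq i - size s1 | i <- [seq i <- B | P2 i]]; first by rewrite size_map.
  split.
  - rewrite map_inj_in_uniq ?filter_uniq // => i j.
    by rewrite !mem_filter /P2 => /andP[? _] /andP[? _]; lia.
  - move=> _ /mapP[i + ->]; rewrite !mem_filter => /andP[iP /andP[_ iA]].
    by apply/(copy_at_catr _ s1); rewrite subnKC //; apply: Ac.
  move=> _ _ /mapP[i + ->] /mapP[j + ->]; rewrite !mem_filter.
  move=> /andP[iP /andP[_ iA]] /andP[jP /andP[_ jA]]; rewrite /P2 in iP jP.
  have := As i j iA jA; lia.
apply: uniq_le1; first by rewrite !filter_uniq.
move=> i j; rewrite !mem_filter /P1 /P2 /=.
move=> /and3P[i1 i2 iA] /and3P[j1 j2 jA].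
have := As i j iA jA; have := As j i jA iA; lia.
Qed.

Definition signed_count c s : int :=
  (count_copies c s)%:Z - (count_copies (rev c) s)%:Z.

Lemma signed_count_rev c s : 0 < size c ->
  signed_count c (rev s) = (- signed_count c s)%R.
Proof.
move=> c0; rewrite /signed_count count_copies_rev // -{1}[c]revK.
rewrite count_copies_rev ?size_rev //; lia.
Qed.

Lemma signed_count_map c s g :
  signed_count c [seq act g v | v <- s] = signed_count c s.
Proof. by rewrite /signed_count !count_copies_map. Qed.

Lemma signed_count_cat c s1 o s2 : 2 < size c ->
  (`|signed_count c (s1 ++ o :: s2)
     - (signed_count c (rcons s1 o) + signed_count c (o :: s2))| <= 1)%R.
Proof.
move=> c2; have c2' : 2 < size (rev c) by rewrite size_rev.
have := count_copies_sub s1 o s2 c2; have := count_copies_super s1 o s2 c2.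
have := count_copies_sub s1 o s2 c2'; have := count_copies_super s1 o s2 c2'.
rewrite /signed_count; lia.
Qed.

End Counting.

(** * The counting quasimorphism of a tree action *)

Section TreeAction.
Variables (G : groupType) (V : eqType) (act : G -> V -> V) (adj : rel V).
Hypothesis actM : forall g h v, act (g * h)%g v = act g (act h v).
Hypothesis act1 : forall v, act 1%g v = v.
Hypothesis adjC : symmetric adj.
Hypothesis adj_act : forall g v w, adj (act g v) (act g w) = adj v w.
Hypothesis no_closed_walk :
  forall x p, reduced adj (x :: p) -> last x p = x -> p = [::].
Hypothesis connected :
  forall x y, exists2 p, reduced adj (x :: p) & last x p = y.

Lemma actKV g : cancel (act g^-1%g) (act g).
Proof. by move=> v; rewrite -actM mulgV act1. Qed.

Lemma actK g : cancel (act g) (act g^-1%g).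
Proof. by move=> v; rewrite -actM mulVg act1. Qed.

Lemma act_inj g : injective (act g).
Proof. exact: can_inj (actK g). Qed.

Lemma reduced_act g s : reduced adj [seq act g v | v <- s] = reduced adj s.
Proof.
elim: s => // x [|y [|z s]] //= IHs; rewrite adj_act ?(inj_eq (@act_inj g)) //.
by rewrite -IHs.
Qed.

Lemma geodesic_subproof x y : exists p, reduced adj (x :: p) /\ last x p = y.
Proof. by have [p] := connected x y; exists p. Qed.

Definition geodesic x y : seq V := x :: sval (cid (geodesic_subproof x y)).

Lemma geodesicE x p : reduced adj (x :: p) -> geodesic x (last x p) = x :: p.
Proof.
rewrite /geodesic; case: cid => q [/= xq lq] xp; congr (_ :: _).
exact: (reduced_inj adjC no_closed_walk xq xp lq).
Qed.

Lemma geodesicP x y : exists2 p, geodesic x y = x :: p &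
  reduced adj (x :: p) /\ last x p = y.
Proof. by rewrite /geodesic; case: cid => p /=; exists p. Qed.

Lemma geodesic_eq x y s : reduced adj s -> head x s = x -> last y s = y ->
  0%N != size s -> geodesic x y = s.
Proof. by case: s => // z s zs /= zx <- _; rewrite -zx; apply: geodesicE. Qed.

Lemma geodesic_rev x y : geodesic y x = rev (geodesic x y).
Proof.
have [p -> [xp <-]] := geodesicP x y.
apply: geodesic_eq; rewrite ?size_rev //; first by rewrite reduced_rev.
  by rewrite lastI rev_rcons.
by rewrite rev_cons last_rcons.
Qed.

Lemma geodesic_act g x y :
  geodesic (act g x) (act g y) = [seq act g v | v <- geodesic x y].
Proof.
have [p -> [xp <-]] := geodesicP x y; rewrite -last_map.
by apply: (@geodesicE _ [seq act g v | v <- p]); rewrite -map_cons reduced_act.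
Qed.

Section Counting.
Variables (c : seq V) (o : V).
Hypothesis c2 : (2 < size c)%N.

Definition walk_count (g : G) : int := signed_count act c (geodesic o (act g o)).

Lemma walk_countV g : walk_count g^-1%g = - walk_count g.
Proof.
rewrite /walk_count -[X in geodesic X _](actK g) geodesic_act.
rewrite (signed_count_map actM act1) geodesic_rev signed_count_rev //; lia.
Qed.

(** The geodesics between o, g o and g h o form a tripod.  The contributions of its
    legs cancel, as reversal changes the sign of the count, and each of the three
    sides crosses the centre once. *)
Lemma walk_countM g h :
  `|walk_count (g * h)%g - (walk_count g + walk_count h)| <= 3.
Proof.
have [p pE [rp lp]] := geodesicP o (act g o).
have [q qE [rq lq]] := geodesicP o (act (g * h)%g o).
have [a [v [b [d [ab ad bd]]]]] := common_prefix o p q.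
have h_E : walk_count h = signed_count act c (rev b ++ v :: d).
  rewrite /walk_count -(signed_count_map actM act1 _ _ g) -geodesic_act -actM.
  congr signed_count; apply: geodesic_eq.
  - by apply: (reduced_tripod adjC _ _ bd (a := a)); rewrite -?ab -?ad.
  - rewrite -lp -[last o p]/(last v (o :: p)) ab last_cat /=.
    by case: (lastP b) => // b' u; rewrite rev_rcons last_rcons.
  - by rewrite last_cat /= -lq -[last o q]/(last v (o :: q)) ad last_cat.
  - by rewrite size_cat /=; lia.
rewrite h_E /walk_count pE qE ab ad.
have := signed_count_cat act (rev b) v d c2.
have := signed_count_cat act a v b c2.
have := signed_count_cat act a v d c2.
have -> : rcons (rev b) v = rev (v :: b) by rewrite rev_cons.
rewrite signed_count_rev //; last by lia.
move: (signed_count _ _ _) (signed_count _ _ _) (signed_count _ _ _) => x y z.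
move: (signed_count _ _ _) (signed_count _ _ _) (signed_count _ _ _) => x' y' z'.
lia.
Qed.

End Counting.

Section Axis.
Variables (g : G) (L : nat) (ax : int -> V).
Hypothesis L0 : (0 < L)%N.
Hypothesis ax_adj : forall i, adj (ax i) (ax (i + 1)).
Hypothesis ax_nobt : forall i, ax i != ax (i + 2).
Hypothesis ax_g : forall i, act g (ax i) = ax (i + L%:Z).

Definition segment (i : int) n : seq V := [seq ax (i + k%:Z) | k <- iota 0 n].

Lemma reduced_segment i n : reduced adj (segment i n).
Proof.
have sucE j : i + j.+1%:Z = i + j%:Z + 1 by lia.
rewrite /segment; move: 0%N => j; elim: n j => // -[|[|n]] IHn j //=.
  by rewrite andbT sucE ax_adj.
apply/and3P; split; last exact: IHn.
  by rewrite sucE ax_adj.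
by rewrite !sucE -addrA ax_nobt.
Qed.

Lemma ax_gX n i : act (g ^+ n)%g (ax i) = ax (i + (n * L)%N%:Z).
Proof.
clear L0.
elim: n i => [|n IHn] i; first by rewrite act1 mul0n addr0.
by rewrite expgS actM IHn ax_g; congr ax; lia.
Qed.

Lemma nth_segment v i n k : (k < n)%N -> nth v (segment i n) k = ax (i + k%:Z).
Proof. by move=> kn; rewrite (nth_map 0%N) ?size_iota // nth_iota. Qed.

(** The axis contains a copy of the window [e, e + L] in each period and no copy of
    the reversed window, so the count of copies of this window grows like n on
    g ^+ n. *)
Theorem well_aligned_bound (e : int) :
  (forall h (d : int), ~ (forall k : nat, (k <= L.+1)%N ->
     act h (ax (e + k%:Z)) = ax (d - k%:Z))) ->
  forall n k, is_comm_prod (g ^+ n)%g k -> (n <= 12 * k)%N.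
Proof.
move=> wa.
pose c := segment e L.+2; pose o := ax e.
have c_sz : size c = L.+2 by rewrite size_map size_iota.
have c2 : (2 < size c)%N by rewrite c_sz.
have geoE n : geodesic o (act (g ^+ n)%g o) = segment e (n * L).+1.
  apply: geodesic_eq; first exact: reduced_segment.
  - by rewrite /= addr0.
  - by rewrite -nth_last size_map size_iota succnK nth_segment // ax_gX.
  - by [].
have low n : n%:Z - 1 <= walk_count c o (g ^+ n)%g.
  rewrite /walk_count geoE /signed_count.
  have -> : count_copies act (rev c) (segment e (n * L).+1) = 0%N.
    have [[|i A] <- // [_ Ac _]] := count_copiesP act (rev c) (segment e (n * L).+1).
    have {Ac}ic := Ac i (mem_head _ _); have iz : (i + L.+2 <= (n * L).+1)%N.
      have := copy_at_size _ ic; rewrite size_rev c_sz size_map size_iota.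
      exact.
    case: ic => h hE; case: (wa h (e + i%:Z + L.+1%:Z)) => k kL.
    have := congr1 (fun s => nth o s (L.+1 - k)%N) hE.
    rewrite size_rev c_sz (nth_map o) ?size_rev ?c_sz; last lia.
    rewrite nth_rev ?c_sz; last lia.
    rewrite nth_take; last lia.
    rewrite nth_drop !nth_segment; [|lia|lia].
    have -> : (L.+2 - (L.+1 - k).+1)%N = k by lia.
    by move->; congr ax; lia.
  suff : (n.-1 <= count_copies act c (segment e (n * L).+1))%N by lia.
  apply: count_copies_ge; first lia.
  exists [seq (j * L)%N | j <- iota 0 n.-1]; first by rewrite size_map size_iota.
  split.
  - rewrite map_inj_uniq ?iota_uniq // => i j /eqP.
    by rewrite eqn_pmul2r // => /eqP.
  - move=> _ /mapP[j + ->]; rewrite mem_iota => jn; exists (g ^+ j)%g.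
    rewrite c_sz /segment -map_drop -map_take drop_iota take_iota.
    have -> : minn L.+2 ((n * L).+1 - j * L) = L.+2.
      apply/minn_idPl; have : (j.+2 * L <= n * L)%N by rewrite leq_mul2r; lia.
      by rewrite !mulSn; lia.
    rewrite -[0%N]/(0 + 0)%N addn0 addnC iotaDl -!map_comp.
    apply: eq_map => k /=; rewrite ax_gX; congr ax; lia.
  - move=> _ _ /mapP[i _ ->] /mapP[j _ ->]; rewrite c_sz ltn_mul2r L0 /= => ij.
    have : (i.+1 * L <= j * L)%N by rewrite leq_mul2r ij orbT.
    by rewrite mulSn; lia.
(* Passing to g ^+ (2 n) absorbs the additive error: 2 n - 1 <= 24 k forces
   n <= 12 k. *)
move=> n k nk; have {}nk := is_comm_prodX 2 nk.
have := quasimorphism_comm_prod (walk_countV o c2) (walk_countM o c2) nk.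
rewrite -expgnA; have := low (n * 2)%N; move: (walk_count _ _ _) => x; lia.
Qed.

End Axis.
End TreeAction.

(** * Integer powers *)

Section IntegerPowers.
Variable G : groupType.
Local Open Scope group_scope.
Implicit Types (x y : G) (i j k : int) (n : nat).

Lemma expgzN x k : expgz x (- k)%R = (expgz x k)^-1.
Proof. by case: k => [[|n]|n] //=; rewrite ?invg1 ?invgK. Qed.

Lemma expgzS x k : expgz x (k + 1)%R = x * expgz x k.
Proof.
case: k => [n|n] /=; first by rewrite addn1 expgS.
case: n => [|n] /=; first by rewrite mulgV.
rewrite subSS subn0 /= [in RHS]expgSr invgM mulgA mulgV mul1g //.
Qed.

Lemma expgzD x i j : expgz x (i + j)%R = expgz x i * expgz x j.
Proof.
have nat_case n k : expgz x (n%:Z + k)%R = expgz x n%:Z * expgz x k.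
  elim: n => [|n IHn]; first by rewrite add0r mul1g.
  have -> : (n.+1%:Z + k = n%:Z + k + 1)%R by lia.
  have -> : (n.+1%:Z = n%:Z + 1)%R by lia.
  by rewrite !expgzS IHn mulgA.
case: i => [n|n]; first exact: nat_case.
have -> : Negz n = (- n.+1%:Z)%R by lia.
rewrite expgzN -[in RHS](addrNK n.+1%:Z j) addrC [(_ - _ + _)%R]addrC.
by rewrite nat_case mulKg.
Qed.

Lemma expgzMn x k n : expgz x (k * n%:Z)%R = expgz x k ^+ n.
Proof.
elim: n => [|n IHn]; first by rewrite mulr0.
by rewrite -[n.+1]addn1 PoszD mulrDr mulr1 expgzD IHn addn1 expgSr.
Qed.

Lemma expgzM x i j :
  expgz x (i * j)%R = expgz (expgz x i) j.
Proof.
case: j => n; first exact: expgzMn.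
by rewrite NegzE mulrN !expgzN expgzMn.
Qed.

Lemma expgz_conj x y k : expgz (y * x * y^-1) k = y * expgz x k * y^-1.
Proof.
have natE n : (y * x * y^-1) ^+ n = y * x ^+ n * y^-1.
  elim: n => [|n IHn]; first by rewrite mulg1 mulgV.
  by rewrite !expgS IHn !mulgA mulgVK.
by case: k => n /=; rewrite natE // !invgM invgK mulgA.
Qed.

End IntegerPowers.

(** * The Bass-Serre tree of a Baumslag-Solitar group *)

Section SequenceTree.
Variable T : eqType.
Implicit Types (x : T) (u v w : seq T) (p : seq (seq T)).

Definition child u v : bool := (v != [::]) && (u == take (size v).-1 v).

Lemma childP u v : reflect (exists x, v = rcons u x) (child u v).
Proof.
apply: (iffP andP) => [[]|[x ->]].
  case/lastP: v => // v x _; rewrite size_rcons /= -cats1 take_size_cat //.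
  by move=> /eqP ->; exists x; rewrite cats1.
rewrite -size_eq0 size_rcons /=; split=> //.
by rewrite -cats1 take_size_cat.
Qed.

Lemma child_rcons u x : child u (rcons u x).
Proof. by apply/childP; exists x. Qed.

(** Finite sequences form a tree, in which the parent of a sequence is obtained by
    deleting its last entry. *)
Definition seq_adj u v : bool := child u v || child v u.

Lemma seq_adjC : symmetric seq_adj.
Proof. by move=> u v; rewrite /seq_adj orbC. Qed.

Lemma child_inj u v w : child u w -> child v w -> u = v.
Proof. by move=> /andP[_ /eqP ->] /andP[_ /eqP ->]. Qed.

Lemma child_size u v : child u v -> size v = (size u).+1.
Proof. by move=> /childP[x ->]; rewrite size_rcons. Qed.

(** A reduced walk that has once moved away from the root cannot turn back. *)
Lemma reduced_up u v p : reduced seq_adj (u :: v :: p) -> child u v ->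
  (size u < size (last v p))%N.
Proof.
elim: p u v => [|w p IHp] u v; first by move=> _ /child_size /= ->.
move=> /= /and3P[_ uw vwp] uv.
have vw : child v w.
  move: (vwp) => /andP[/orP[//|wv] _].
  by rewrite (child_inj uv wv) eqxx in uw.
by apply: leq_trans (IHp v w vwp vw); rewrite (child_size uv) leqW.
Qed.

(** By [reduced_up], a closed reduced walk has to leave its base point towards the
    root and, read backwards, has to do so again: it backtracks at its base point,
    and what is left is a shorter closed reduced walk. *)
Lemma seq_no_closed_walk u p : reduced seq_adj (u :: p) -> last u p = u -> p = [::].
Proof.
move: {2}(size p).+1 (ltnSn (size p)) => n; elim: n u p => // n IHn u [//|v p].
move=> pn red lE; exfalso.
have down q w : reduced seq_adj (u :: w :: q) -> last w q = u -> child w u.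
  move=> uwq lw; have /= /andP[/orP[uw|//] _] := uwq.
  by have := reduced_up uwq uw; rewrite lw ltnn.
have vu := down _ _ red lE.
case/lastP: p => [|p w] in pn red lE *.
  by rewrite /= in lE; rewrite lE in vu; have := child_size vu; lia.
rewrite /= last_rcons in lE; rewrite lE in red pn.
have [v' [q qE]] : exists v' q, v :: p = rcons q v'.
  by exists (last v p), (belast v p); rewrite lastI.
have red' : reduced seq_adj (u :: v' :: rcons (rev q) u).
  have -> : [:: u, v' & rcons (rev q) u] = rev (u :: rcons (v :: p) u).
    by rewrite rev_cons rev_rcons qE rev_rcons.
  by rewrite (reduced_rev seq_adjC).
have v'u : child v' u by apply: (down _ _ red'); rewrite last_rcons.
have vv' := child_inj vu v'u.
have redvp : reduced seq_adj (v :: p).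
  by apply: (@reduced_catl _ _ seq_adjC _ [:: u]); rewrite cats1;
     apply: (@reduced_catr _ _ [:: u]).
have := IHn v p; rewrite /= size_rcons ltnS in pn; rewrite (ltnW pn) => /(_ isT redvp).
have -> : last v p = v by have := lastI v p; rewrite qE => /rcons_inj[_ <-].
move=> /(_ erefl) p0; rewrite p0 /= in red.
by move: red; rewrite eqxx andbF.
Qed.

End SequenceTree.

Lemma neq_negb (b b' : bool) : b' != b -> b' = ~~ b.
Proof. by case: b; case: b'. Qed.

Section BassSerreTree.
Variables m l : int.
Hypotheses (m0 : m != 0) (l0 : l != 0).
Let letter := (int * bool)%type.
Implicit Types (b : bool) (k r : int) (s : seq letter) (w : word bool).

(** The letter t ^ b with b = true stands for the inverse of t, and
    a ^ (q * edge_index b) t^b = t^b a ^ (q * edge_index (~~ b)).  So cosets of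
    the powers of a to the left of t^b have representatives in the residues modulo
    [edge_index b]. *)
Definition edge_index b : int := if b then m else l.

Lemma edge_index_neq0 b : edge_index b != 0.
Proof. by case: b. Qed.

Definition head_ok b s : bool :=
  if s is (r, b') :: _ then ~~ ((r == 0) && (b' != b)) else true.

(** The sequence (r1, b1), ..., (rn, bn) encodes the coset
    a^r1 t^b1 ... a^rn t^bn <a>; these conditions are those of the normal form of an
    HNN extension. *)
Fixpoint normal s : bool :=
  if s is (r, b) :: s' then
    [&& (r %% edge_index b)%Z == r, head_ok b s' & normal s']
  else true.

(** The left multiplication of a coset by a^k. *)
Fixpoint shift k s : seq letter :=
  if s is (r, b) :: s' then
    (((k + r) %% edge_index b)%Z, b) ::
      shift (((k + r) %/ edge_index b)%Z * edge_index (~~ b)) s'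
  else [::].

(** The left multiplication of a coset by t^b. *)
Definition push b s : seq letter :=
  if s is (r, b') :: s' then
    if (r == 0) && (b' != b) then s' else (0, b) :: s
  else [:: (0, b)].

Lemma shift_head_ok b q s : normal s -> head_ok b s ->
  head_ok b (shift (q * edge_index (~~ b)) s).
Proof.
case: s => [|[r b'] s] //= /and3P[/eqP rE _ _].
have [->|b'b] := eqVneq b' b; first by rewrite !andbF.
by rewrite -(neq_negb b'b) modzMDl rE !andbT.
Qed.

Lemma shift_normal k s : normal s -> normal (shift k s).
Proof.
elim: s k => [|[r b] s IHs] k //= /and3P[/eqP rE bs ns].
by rewrite modz_mod eqxx IHs // shift_head_ok.
Qed.

Lemma shift0 s : normal s -> shift 0 s = s.
Proof.
elim: s => [|[r b] s IHs] //= /and3P[/eqP rE _ ns]; rewrite add0r rE.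
suff -> : (r %/ edge_index b)%Z = 0 by rewrite mul0r IHs.
apply/eqP; have := divz_eq r (edge_index b); rewrite rE => /eqP.
by rewrite -subr_eq subrr eq_sym mulf_eq0 (negPf (edge_index_neq0 b)) orbF.
Qed.

Lemma shiftD k j s : shift k (shift j s) = shift (k + j) s.
Proof.
elim: s k j => [|[r b] s IHs] k j //=.
have d0 := edge_index_neq0 b.
have E := divz_eq (j + r) (edge_index b).
have -> : k + j + r = ((j + r) %/ edge_index b)%Z * edge_index b
                      + (k + ((j + r) %% edge_index b)%Z).
  by rewrite addrCA -E addrA.
rewrite IHs -mulrDl modzMDl divzMDl //.
by congr (_ :: shift (_ * _) s); rewrite addrC.
Qed.

Lemma push_normal b s : normal s -> normal (push b s).
Proof.
case: s => [|[r b'] s] /=; first by rewrite mod0z eqxx.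
move=> /and3P[rE bs ns]; case: ifP => // rb /=; rewrite mod0z eqxx rE bs ns !andbT /=.
by rewrite rb.
Qed.

Lemma push_ok b s : head_ok b s -> push b s = (0, b) :: s.
Proof. by case: s => [|[r b'] s] //= /negPf ->. Qed.

Lemma pushK b s : normal s -> push (~~ b) (push b s) = s.
Proof.
case: s => [|[r b'] s] /=; first by case: b.
move=> /and3P[rE bs ns]; case: ifP => [/andP[/eqP r_0 b'b]|rb /=].
  by rewrite -(neq_negb b'b) push_ok // r_0.
by case: b {rb}.
Qed.

Lemma push_shift b q s : normal s ->
  push b (shift (q * edge_index (~~ b)) s) = shift (q * edge_index b) (push b s).
Proof.
move=> ns; have [bs|] := boolP (head_ok b s).
  rewrite !push_ok ?shift_head_ok //= addr0 modzMl mulzK ?edge_index_neq0 //.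
case: s ns => [|[r b'] s] //= /and3P[rE bs ns]; rewrite negbK => rb.
have /andP[/eqP r_0 b'b] := rb; rewrite rb.
rewrite (neq_negb b'b) r_0 addr0 modzMl eqxx /= mulzK ?edge_index_neq0 // negbK.
by case: (b).
Qed.

Definition letter_act (p : bool * bool) s : seq letter :=
  if p.1 then push p.2 s else shift (if p.2 then -1 else 1) s.

Definition word_act w s : seq letter := foldr letter_act s w.

Lemma letter_act_normal p s : normal s -> normal (letter_act p s).
Proof.
by rewrite /letter_act; case: p.1 => ns; [apply: push_normal|apply: shift_normal].
Qed.

Lemma word_act_normal w s : normal s -> normal (word_act w s).
Proof. by move=> ns; elim: w => //= p w; apply: letter_act_normal. Qed.

Lemma word_act_cat w1 w2 s : word_act (w1 ++ w2) s = word_act w1 (word_act w2 s).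
Proof. by rewrite /word_act foldr_cat. Qed.

Lemma letter_actK x b s : normal s ->
  letter_act (x, ~~ b) (letter_act (x, b) s) = s.
Proof.
rewrite /letter_act; case: x => ns /=; first exact: pushK.
by rewrite shiftD; case: b; rewrite /= ?subrr ?addNr shift0.
Qed.

Lemma word_act_apow k s : normal s -> word_act (wpow bs_a k) s = shift k s.
Proof.
move=> ns.
have nseqE n b : word_act (nseq n (bs_a, b)) s = shift (if b then - n%:Z else n%:Z) s.
  elim: n => [|n IHn] /=; first by rewrite oppr0 if_same shift0.
  rewrite IHn /letter_act /= shiftD; congr (shift _ s); case: b {IHn}; lia.
case: k => n; first exact: nseqE.
by rewrite [LHS]nseqE NegzE.
Qed.

(** The relation of the group holds for the permutations [shift] and [push], as
    shown by [push_shift], so words act through the group. *)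
Lemma word_act_pres u v s : normal s -> pres_eq (bs_rels m l) u v ->
  word_act u s = word_act v s.
Proof.
move=> + uv; elim: uv s => {u v} [w|u v _ uv|v u w _ uv _ vw|w1 w2 x b|w1 w2 u v [-> ->]] s ns //.
- by rewrite uv.
- by rewrite uv // vw.
- rewrite !word_act_cat /= -[b in (_, b)]negbK letter_actK //.
  exact: word_act_normal.
rewrite !word_act_cat; congr (word_act w1).
have ns' := word_act_normal w2 ns.
rewrite !word_act_apow // /=; last exact: push_normal.
rewrite /letter_act /=.
have := @push_shift false 1 (push true (word_act w2 s)) (push_normal _ ns').
by rewrite !mul1r => ->; rewrite (@pushK true).
Qed.

Lemma shift_child k u v : child u v -> child (shift k u) (shift k v).
Proof.
move=> /childP[x ->]; apply/childP.
elim: u k => [|[r b] u IHu] k /=; 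
  first by case: x => r b; exists (((k + r) %% edge_index b)%Z, b).
by have [y ->] := IHu (((k + r) %/ edge_index b)%Z * edge_index (~~ b)); exists y.
Qed.

Lemma push_adj b u v : child u v -> seq_adj (push b u) (push b v).
Proof.
move=> /childP[x ->]; case: u => [|[r b'] u] /=.
  case: x => r b'; case: ifP => _; first by rewrite /seq_adj (child_rcons [::]) orbT.
  by rewrite /seq_adj (child_rcons [:: _]).
case: ifP => _; first by rewrite /seq_adj child_rcons.
by rewrite -!rcons_cons /seq_adj child_rcons.
Qed.

Lemma letter_act_adj p u v : seq_adj u v -> seq_adj (letter_act p u) (letter_act p v).
Proof.
rewrite /letter_act; case: p.1.
  by move=> /orP[]/(push_adj p.2)//; rewrite seq_adjC.
by move=> /orP[]/(shift_child (if p.2 then -1 else 1)) uv;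
  rewrite /seq_adj uv ?orbT.
Qed.

Lemma word_act_adj w u v : seq_adj u v -> seq_adj (word_act w u) (word_act w v).
Proof. by move=> uv; elim: w => //= p w; apply: letter_act_adj. Qed.

Definition sgn b : int := if b then -1 else 1.

Definition height s : int := \sum_(p <- s) sgn p.2.

Definition word_height w : int := \sum_(p <- w | p.1) sgn p.2.

Lemma height_cons r b s : height ((r, b) :: s) = sgn b + height s.
Proof. by rewrite /height big_cons. Qed.

Lemma height_shift k s : height (shift k s) = height s.
Proof.
by elim: s k => [|[r b] s IHs] k //=; rewrite !height_cons IHs.
Qed.

Lemma height_push b s : height (push b s) = sgn b + height s.
Proof.
case: s => [|[r b'] s] /=; first by rewrite height_cons.
case: ifP => [/andP[_ b'b]|_]; last by rewrite height_cons.
by rewrite height_cons addrA; move: b'b; case: b; case: b' => //= _; rewrite /sgn ?subrr ?addNr add0r.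
Qed.

Lemma height_word_act w s : height (word_act w s) = word_height w + height s.
Proof.
elim: w => [|[[] b] w IHw] /=; rewrite /word_height ?big_nil ?add0r // big_cons.
  by rewrite /= height_push IHw addrA.
by rewrite height_shift IHw.
Qed.

Definition vertex := {s : seq letter | normal s}.
Implicit Types (g h : BS m l) (v : vertex).

Definition root : vertex := exist _ [::] isT.

Definition bs_act g v : vertex :=
  exist _ (word_act (repr g) (val v)) (word_act_normal (repr g) (valP v)).

Lemma val_bs_act_class w v :
  val (bs_act (pres_class (bs_rels m l) w) v) = word_act w (val v).
Proof.
apply: word_act_pres; first exact: (valP v).
by apply/pres_classP; rewrite pres_classK.
Qed.

Lemma bs_actM g h v : bs_act (g * h)%g v = bs_act g (bs_act h v).
Proof. by apply: val_inj; rewrite val_bs_act_class word_act_cat. Qed.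

Lemma bs_act1 v : bs_act 1%g v = v.
Proof. by apply: val_inj; rewrite val_bs_act_class. Qed.

Definition bs_adj : rel vertex := fun u v => seq_adj (val u) (val v).

Lemma bs_adjC : symmetric bs_adj.
Proof. by move=> u v; apply: seq_adjC. Qed.

Lemma bs_adj_act g u v : bs_adj (bs_act g u) (bs_act g v) = bs_adj u v.
Proof.
apply/idP/idP; last exact: word_act_adj.
move=> /(word_act_adj (repr g^-1%g)).
by rewrite -[seq_adj _ _]/(bs_adj (bs_act _ (bs_act _ _)) (bs_act _ (bs_act _ _)))
  -!bs_actM !mulVg !bs_act1.
Qed.

Lemma reduced_val (p : seq vertex) :
  reduced (@seq_adj _) (map val p) = reduced bs_adj p.
Proof. by elim: p => // x [|y [|z p]] //= <-. Qed.

Lemma bs_no_closed_walk u (p : seq vertex) :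
  reduced bs_adj (u :: p) -> last u p = u -> p = [::].
Proof.
rewrite -reduced_val => /= red /(congr1 val); rewrite -last_map => lE.
by have /(congr1 size) := seq_no_closed_walk red lE; rewrite size_map => /size0nil.
Qed.

Lemma normal_catl s1 s2 : normal (s1 ++ s2) -> normal s1.
Proof.
elim: s1 => [|[r b] s1 IHs] //= /and3P[-> hb /IHs ->]; rewrite /= andbT.
by case: s1 hb {IHs} => [|[]].
Qed.

(** The property of being joined to v by a reduced walk passes to adjacent
    vertices, and prefixes of normal sequences are normal. *)
Lemma bs_connected u v : exists2 p, reduced bs_adj (u :: p) & last u p = v.
Proof.
pose P s := forall ns : normal s,
  exists2 p, reduced bs_adj ((exist _ s ns : vertex) :: p) & last (exist _ s ns) p = v.
have Pstep s1 s2 : normal s1 -> seq_adj s1 s2 -> P s1 -> P s2.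
  move=> ns1 s12 P1 ns2; have [p red lE] := P1 ns1.
  set x := exist _ s1 ns1 in red lE; set y : vertex := exist _ s2 ns2.
  have yx : bs_adj y x by rewrite bs_adjC.
  case: p red lE => [|z p] red lE; first by exists [:: x] => //=; rewrite yx.
  have [zy|zy] := eqVneq y z.
    by exists p => //; rewrite zy //; apply: (@reduced_catr _ _ [:: x]).
  by exists [:: x, z & p] => //; apply/and3P.
have Proot : P [::].
  have Pv : P (val v).
    by move=> ns; exists [::] => //; apply: val_inj.
  elim/last_ind: (val v) (valP v) Pv => // s x IHs nsx Psx.
  have ns : normal s by move: nsx; rewrite -cats1 => /normal_catl.
  by apply: IHs ns _; apply: (Pstep _ _ nsx _ Psx); rewrite /seq_adj child_rcons orbT.
case: u => s; elim/last_ind: s => // s x IHs nsx.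
have ns : normal s by move: (nsx); rewrite -cats1 => /normal_catl.
by apply: (Pstep _ _ ns _ IHs nsx); rewrite /seq_adj child_rcons.
Qed.

End BassSerreTree.

(** * Vertex stabilizers *)

(** The ring of integers is integrally closed. *)
Lemma rat_root_int (w : rat) (n : nat) (c : int) :
  (0 < n)%N -> w ^+ n = c%:~R -> exists k : int, w = k%:~R.
Proof.
move=> n0 wc; exists (numq w); rewrite -[LHS]divq_num_den.
suff -> : denq w = 1 by rewrite divr1.
have E : numq w ^+ n = c * denq w ^+ n.
  apply: (@intr_inj rat); rewrite rmorphM !rmorphXn /= -wc -exprMn.
  by congr (_ ^+ _); rewrite mulrC numqE mulrC.
have dv : (denq w %| numq w ^+ n)%Z.
  by rewrite E; case: n n0 {E wc} => // n _; rewrite exprS mulrCA dvdz_mulr.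
have cop : coprimez (denq w) (numq w ^+ n).
  by rewrite coprimezXr // coprimez_sym coprimezE coprime_num_den.
have : (denq w %| 1)%Z by rewrite -(Gauss_dvdzr _ cop) mulr1.
by rewrite dvdz1 => /eqP; have := denq_gt0 w; case: (denq w) => // d _ /= ->.
Qed.

Section Stabilizers.
Variables m l : int.
Hypotheses (m0 : m != 0) (l0 : l != 0).
Local Notation a := (BSa m l).
Local Notation t := (BSt m l).
Local Notation root := (root m l).
Local Notation vertex := (vertex m l).
Local Notation act := (@bs_act m l).
Local Notation adj := (@bs_adj m l).
Local Notation actM := (bs_actM m0 l0).
Local Notation act1 := (bs_act1 m0 l0).
Implicit Types (g h x y z : BS m l) (b : bool) (i j k : int) (u v : vertex).

Definition stable_letter b : BS m l := if b then t^-1%g else t.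
Local Notation tb := stable_letter.

Lemma stable_letterE b : tb b = pres_class (bs_rels m l) [:: (bs_t, b)].
Proof. by case: b => //; rewrite /stable_letter; apply: pres_invE. Qed.

Lemma act_apow k v : val (act (expgz a k) v) = shift m l k (val v).
Proof.
have -> : expgz a k = pres_class (bs_rels m l) (wpow bs_a k).
  by rewrite pres_class_wpow.
by rewrite (val_bs_act_class m0 l0) (word_act_apow m0 l0) //; exact: (valP v).
Qed.

Lemma act_stable_letter b v : val (act (tb b) v) = push b (val v).
Proof. by rewrite stable_letterE (val_bs_act_class m0 l0). Qed.

Lemma apow_stable_letter b q :
  (expgz a (q * edge_index m l b) * tb b
   = tb b * expgz a (q * edge_index m l (~~ b)))%g.
Proof.
have rel : (t * expgz a (q * m)%R * t^-1 = expgz a (q * l)%R)%g.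
  by rewrite ![(q * _)%R]mulrC !expgzM -BS_relation expgz_conj.
by case: b => /=; rewrite -rel ?mulgA ?mulVg ?mul1g // mulgVK.
Qed.

Fixpoint node_elt (s : seq (int * bool)) : BS m l :=
  if s is (r, b) :: s' then (expgz a r * tb b * node_elt s')%g else 1%g.

Lemma act_node_elt v : act (node_elt (val v)) root = v.
Proof.
apply: val_inj; elim: (val v) (valP v) => [|[r b] s IHs] ns.
  by rewrite [node_elt _]/= act1.
have /and3P[/eqP rE bs ns'] := ns.
rewrite [node_elt _]/= !actM act_apow act_stable_letter IHs //.
by rewrite (push_ok bs) /= addr0 -[RHS](shift0 m0 l0 ns) /= add0r.
Qed.

Lemma act_transitive v : exists x, act x root = v.
Proof. by exists (node_elt (val v)); apply: act_node_elt. Qed.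

Lemma apow_node_elt k s : exists j,
  (expgz a k * node_elt s = node_elt (shift m l k s) * expgz a j)%g.
Proof.
elim: s k => [|[r b] s IHs] k; first by exists k; rewrite /= mul1g mulg1.
have [j jE] := IHs (((k + r) %/ edge_index m l b)%Z * edge_index m l (~~ b)).
exists j => /=; rewrite -!mulgA -jE !mulgA -expgzD; congr (_ * _)%g.
rewrite -[RHS]mulgA -apow_stable_letter mulgA -expgzD; congr (expgz _ _ * _)%g.
by rewrite [RHS]addrC -divz_eq.
Qed.

Lemma stable_letter_node_elt b s :
  (tb b * node_elt s = node_elt (push b s))%g.
Proof.
case: s => [|[r b'] s] /=; first by rewrite mul1g.
case: ifP => [/andP[/eqP -> b'b]|_] /=; last by rewrite mul1g.
rewrite mul1g mulgA (neq_negb b'b) /stable_letter.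
by case: (b) => /=; rewrite ?mulVg ?mulgV mul1g.
Qed.

(** Reading the action on cosets in the group itself: this is what shows that the
    stabilizer of the root is no larger than <a>. *)
Lemma word_node_elt w s : exists j,
  (pres_class (bs_rels m l) w * node_elt s
   = node_elt (word_act m l w s) * expgz a j)%g.
Proof.
elim: w => [|[x b] w [j jE]] /=; first by exists 0; rewrite mul1g mulg1.
have -> : pres_class (bs_rels m l) ((x, b) :: w)
          = (pres_class (bs_rels m l) [:: (x, b)] * pres_class (bs_rels m l) w)%g.
  by apply: esym; exact: (pres_mulE _ [:: (x, b)] w).
rewrite -mulgA jE /letter_act /=; case: x => /=.
  by exists j; rewrite mulgA -stable_letterE stable_letter_node_elt.
set k : int := if b then -1 else 1.
have -> : pres_class (bs_rels m l) [:: (false, b)] = expgz a k.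
  by rewrite /k; case: (b) => //=; apply: esym; apply: pres_invE.
have [j' j'E] := apow_node_elt k (word_act m l w s).
by exists (j' + j); rewrite mulgA j'E expgzD mulgA.
Qed.

Lemma stab_root g : act g root = root -> exists i, g = expgz a i.
Proof.
move=> /(congr1 val) /= gE; have [j] := word_node_elt (repr g) [::].
by rewrite gE /= mulg1 mul1g pres_classK; exists j.
Qed.

Definition t_exponent g : int := word_height (repr g).

Lemma height_act g v : height (val (act g v)) = t_exponent g + height (val v).
Proof. exact: height_word_act. Qed.

Lemma height_adj u v : adj u v ->
  height (val v) = height (val u) + 1 \/ height (val v) = height (val u) - 1.
Proof.
clear m0 l0.
have child_height (s s' : seq (int * bool)) : child s s' ->
    height s' = height s + 1 \/ height s' = height s - 1.
  move=> /childP[[r b] ->]; rewrite /height -cats1 big_cat big_seq1 /=.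
  by case: b; rewrite /sgn; [right|left].
by move=> /orP[]/child_height[]; lia.
Qed.

Lemma adj_root v : adj root v -> exists j b, v = act (expgz a j * tb b)%g root.
Proof.
move=> /orP[/childP[[r b] vE]|/childP[x /=]]; last by case: (val v).
exists r, b; apply: val_inj; rewrite actM act_apow act_stable_letter vE /= addr0.
by have := valP v; rewrite vE /= => /andP[/eqP ->].
Qed.

Lemma adj_act_root x v : adj (act x root) v ->
  exists j b, v = act (x * (expgz a j * tb b))%g root.
Proof.
rewrite -(bs_adj_act m0 l0 x^-1%g) -actM mulVg act1 => /adj_root[j [b vE]].
by exists j, b; rewrite actM -vE -actM mulgV act1.
Qed.

Definition ratio : rat := l%:~R / m%:~R.

Lemma ratio_neq0 : ratio != 0.
Proof. by rewrite mulf_neq0 ?invr_eq0 ?intr_eq0. Qed.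

(** In the commensurability class of <a>, conjugation by t multiplies by the ratio
    l / m.  Accordingly the element x a^i x^-1 of the stabilizer of v = x root is
    recorded by the rational number i (l / m) ^ height v, which does not change
    if v is replaced by another vertex fixed by this element. *)
Definition rotation h v (q : rat) : Prop :=
  exists x i, [/\ act x root = v, h = (x * expgz a i * x^-1)%g
                & q = i%:~R * ratio ^ height (val v)].

(** The values of the elements that fix an edge whose lower end has height n. *)
Definition edge_lattice (n : int) (q : rat) : Prop :=
  exists k : int, q = k%:~R * (l%:~R * ratio ^ n).

Definition edge_height u v : int :=
  if height (val u) <= height (val v) then height (val u) else height (val v).

Lemma rotation_exists h v : act h v = v -> exists q, rotation h v q.
Proof.
have [x <-] := act_transitive v; rewrite -actM => hx.
have [i iE] : exists i, (x^-1 * (h * x))%g = expgz a i.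
  by apply: stab_root; rewrite actM hx -actM mulVg act1.
eexists; exists x, i; split=> //.
by rewrite -iE mulVKg mulgK.
Qed.

Lemma act_apow_root i : act (expgz a i) root = root.
Proof. by apply: val_inj; rewrite act_apow. Qed.

Lemma rotation_fix h v q : rotation h v q -> act h v = v.
Proof.
by move=> [x [i [<- -> _]]]; rewrite -!actM mulgVK !actM act_apow_root.
Qed.

(** The generators x a x^-1 of the stabilizer of v agree for all x with x root = v,
    so v and the value determine the element. *)
Lemma rotation_inj h h' v q : rotation h v q -> rotation h' v q -> h = h'.
Proof.
move=> [x [i [xv -> ->]]] [y [j [yv -> ijE]]].
have ij : i = j.
  apply: (@intr_inj rat); apply: (mulIf _ ijE).
  exact/expfz_neq0/ratio_neq0.
have [k kE] : exists k, (y^-1 * x)%g = expgz a k.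
  by apply: stab_root; rewrite actM xv -yv -actM mulVg act1.
have -> : x = (y * expgz a k)%g by rewrite -kE mulVKg.
rewrite -ij invgM !mulgA -[(y * _ * _)%g]mulgA -expgzD addrC expgzD mulgA.
by rewrite mulgK.
Qed.

Lemma rotation_conj g h v q : t_exponent g = 0 -> rotation h v q ->
  rotation (g * h * g^-1)%g (act g v) q.
Proof.
move=> g0 [x [i [<- -> ->]]]; exists (g * x)%g, i; split.
- by rewrite actM.
- by rewrite invgM !mulgA.
by rewrite [in RHS]height_act g0 add0r.
Qed.

Lemma height_stable_letter x j b :
  height (val (act (x * (expgz a j * tb b))%g root))
  = height (val (act x root)) + sgn b.
Proof.
rewrite actM height_act [in RHS]height_act actM act_apow height_shift act_stable_letter.
by rewrite height_push /=; lia.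
Qed.

Lemma edge_lattice_index k b (n : int) :
  k%:~R * (l%:~R * ratio ^ (if b then n - 1 else n))
  = (k * edge_index m l b)%:~R * ratio ^ n.
Proof.
case: b => /=; rewrite rmorphM /= -mulrA //.
have mR : m%:~R != 0 :> rat by rewrite intr_eq0.
have lR : l%:~R != 0 :> rat by rewrite intr_eq0.
rewrite expfzDr ?ratio_neq0 // exprN1; move: (ratio ^ n) => X.
by rewrite /ratio; field; rewrite mR lR.
Qed.

Lemma edge_height_step u v b : height (val v) = height (val u) + sgn b ->
  edge_height u v = if b then height (val u) - 1 else height (val u).
Proof. clear m0 l0. by rewrite /edge_height /sgn => ->; case: b; case: ifP; lia. Qed.

Lemma edge_heightC u v : edge_height u v = edge_height v u.
Proof. clear m0 l0. by rewrite /edge_height; case: ifP; case: ifP; lia. Qed.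

Lemma rotation_edge_lattice h u v q : adj u v -> rotation h u q ->
  act h v = v -> edge_lattice (edge_height u v) q.
Proof.
move=> uv [x [i [xu hE ->]]]; rewrite -xu in uv *.
have [j [b vE]] := adj_act_root uv.
rewrite (@edge_height_step _ v b); last by rewrite vE height_stable_letter.
rewrite vE -actM hE => /(congr1 (act (x * expgz a j)^-1%g)).
rewrite -!actM; set y := (_ * (_ * _))%g; set y' := (_ * (x * _))%g.
have -> : y = (expgz a i * tb b)%g.
  rewrite /y invgM -!mulgA !mulKg 2!mulgA -expgzN -!expgzD.
  by congr (expgz _ _ * _)%g; lia.
have -> : y' = tb b by rewrite /y' invgM mulgA -mulgA mulgA mulgVK mulKg.
rewrite actM => /(congr1 val); rewrite act_apow act_stable_letter /= addr0.
move=> [i_mod]; have := divz_eq i (edge_index m l b); rewrite i_mod addr0 => ->.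
by eexists; rewrite edge_lattice_index.
Qed.

Lemma rotation_extend h u v q : adj u v -> rotation h u q ->
  edge_lattice (edge_height u v) q -> rotation h v q.
Proof.
move=> uv [x [i [xu hE ->]]]; rewrite -xu in uv *.
have [j [b vE]] := adj_act_root uv.
have hv : height (val v) = height (val (act x root)) + sgn b.
  by rewrite vE height_stable_letter.
rewrite (edge_height_step hv) => -[k]; rewrite edge_lattice_index => ikE.
have ik : i = k * edge_index m l b.
  apply: (@intr_inj rat); apply: (mulIf _ ikE).
  exact/expfz_neq0/ratio_neq0.
exists (x * (expgz a j * tb b))%g, (k * edge_index m l (~~ b)); split=> //.
  rewrite hE !invgM !mulgA -[(_ * tb b * expgz _ _)%g]mulgA.
  rewrite -apow_stable_letter -ik mulgA mulgK.
  by rewrite -[(x * expgz a j * _)%g]mulgA -expgzD addrC expgzD mulgA mulgK.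
rewrite ikE -edge_lattice_index hv.
have := edge_lattice_index k (~~ b) (height (val (act x root)) + sgn b).
by move <-; congr (_ * (_ * _ ^ _)); case: b {vE hv ikE ik}; rewrite /sgn /=; lia.
Qed.

(** If k and k ratio^-N are integers, so is w = k ratio^-i for 0 <= i <= N, because
    w ^ N = k ^ (N - i) (k ratio^-N) ^ i is one. *)
Lemma edge_lattice_between (n1 n n2 : int) q : n1 <= n <= n2 ->
  edge_lattice n1 q -> edge_lattice n2 q -> edge_lattice n q.
Proof.
move=> /andP[n1n nn2] [k1 k1E] [k2 k2E].
have lR : l%:~R != 0 :> rat by rewrite intr_eq0.
have r0 := ratio_neq0.
have [N NE] : exists N : nat, n2 - n1 = N%:Z by exists `|n2 - n1|%N; lia.
have [i iE] : exists i : nat, n - n1 = i%:Z by exists `|n - n1|%N; lia.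
have [N0|Npos] := posnP N; first by exists k1; rewrite k1E; congr (_ * (_ * _ ^ _)); lia.
pose w := k1%:~R / ratio ^+ i.
have k2w : k2%:~R = k1%:~R / ratio ^+ N.
  apply: (mulIf (mulf_neq0 lR (expfz_neq0 n2 r0))); rewrite -k2E k1E.
  have -> : n2 = n1 + N%:Z by lia.
  rewrite expfzDr // -exprnP; field.
  by rewrite expf_neq0.
have [k kE] : exists k : int, w = k%:~R.
  apply: (@rat_root_int w N (k1 ^+ (N - i) * k2 ^+ i)) => //.
  rewrite rmorphM !rmorphXn /= k2w /w !expr_div_n mulrA -exprD subnK; last lia.
  by rewrite -!exprM mulnC.
exists k; rewrite -kE k1E /w; have -> : n = n1 + i%:Z by lia.
rewrite expfzDr // -exprnP; field.
by rewrite expf_neq0.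
Qed.

End Stabilizers.

Section Exponent.
Variables m l : int.
Hypotheses (m0 : m != 0) (l0 : l != 0).
Implicit Types g h : BS m l.
Local Open Scope group_scope.

Lemma t_exponentM g h : t_exponent (g * h) = (t_exponent g + t_exponent h)%R.
Proof.
have := height_act (g * h) (root m l).
by rewrite (bs_actM m0 l0) !height_act addrA => /addIr.
Qed.

Lemma t_exponent_comm_prod g k : is_comm_prod g k -> t_exponent g = 0%R.
Proof.
have t1 : t_exponent (1 : BS m l) = 0%R.
  by have := t_exponentM 1 1; rewrite mulg1 => /eqP; rewrite -subr_eq subrr eq_sym => /eqP.
have tV g' : t_exponent g'^-1 = (- t_exponent g')%R.
  by apply/eqP; rewrite -addr_eq0 -t_exponentM mulVg t1.
move=> [s [_ ->]]; elim: s => [|p s IHs]; first by rewrite big_nil.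
rewrite big_cons t_exponentM IHs /commg /conjg !t_exponentM !tV; lia.
Qed.

Lemma t_exponentX g n : t_exponent (g ^+ n) = (t_exponent g * n%:Z)%R.
Proof.
elim: n => [|n IHn].
  rewrite mulr0; apply: (@t_exponent_comm_prod _ 0).
  by exists [::]; rewrite big_nil.
by rewrite expgS t_exponentM IHn; lia.
Qed.

End Exponent.

(** * Elements with vanishing stable commutator length *)

Section Vanishing.
Variables (R : realType) (m l : int).
Hypotheses (m0 : m != 0) (l0 : l != 0) (ml : m != l).
Local Notation a := (BSa m l).
Local Notation t := (BSt m l).
Local Notation act := (@bs_act m l).
Implicit Types (g h z : BS m l) (v : vertex m l).

Lemma apow_commutator (k : int) :
  expgz a ((m - l) * k) = [~ expgz a (m * - k), t^-1]%g.
Proof.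
have rel j : (t * expgz a (m * j)%R * t^-1 = expgz a (l * j)%R)%g.
  by rewrite [expgz a (m * j)%R]expgzM -expgz_conj BS_relation -expgzM.
rewrite /commg /conjg invgK [(t * _)%g]mulgA rel -expgzN -expgzD.
by congr expgz; lia.
Qed.

(** The stabilizer of v is generated by a conjugate of a. *)
Lemma rotation_power_commutator z v n : act z v = v ->
  is_comm_prod (z ^+ (`|m - l| * n))%g 1.
Proof.
move=> /(rotation_exists m0 l0)[q [x [i [_ -> _]]]].
rewrite -[(_ ^+ _)%g]/(expgz _ (`|m - l| * n)%N%:Z) expgz_conj.
have [k kE] : exists k, i * (`|m - l| * n)%N%:Z = (m - l) * k.
  have [ml0|ml0] := leP 0 (m - l).
    by exists (i * n%:Z); rewrite PoszM gez0_abs //; ring.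
  by exists (- (i * n%:Z)); rewrite PoszM ltz0_abs //; ring.
rewrite -expgzM kE apow_commutator -[X in is_comm_prod (X * _ * _)%g _]invgK -mulgA.
exact/is_comm_prodJ/is_comm_prod_commg.
Qed.

Lemma absz_sub_gt0 : (0 < `|m - l|)%N.
Proof. by rewrite absz_gt0 subr_eq0. Qed.

Lemma scl_elliptic g v : act g v = v -> scl R g = 0%:E.
Proof.
move=> gv; apply: (@scl_eq0 _ _ _ _ 1 absz_sub_gt0) => n.
exact: rotation_power_commutator gv.
Qed.

(** With z = g h g h^-1 the conjugate of g by h is z g^-1.  As z commutes with g,
    comparing n-th powers shows that g ^+ (2 n) is z ^+ n up to one commutator, and
    suitable powers of z are commutators. *)
Lemma scl_inverted g h v : commute g (g * h * g * h^-1)%g ->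
  act (g * h * g * h^-1)%g v = v -> scl R g = 0%:E.
Proof.
set z := (_ * h^-1)%g => gz zv.
have g2 n : (g ^+ (2 * n) = [~ g ^- n, h^-1] * z ^+ n)%g.
  have hgh : (h * g * h^-1 = z * g^-1)%g.
    by rewrite (commuteV (commute_sym gz)) /z !mulgA mulVg mul1g.
  have hghn : (h * g ^+ n * h^-1 = z ^+ n * g ^- n)%g.
    have := expgz_conj g h n%:Z; rewrite /= hgh => <-.
    by rewrite expgnFl //; apply: commute_sym.
  have hgVh : (h * (g ^- n * h^-1) = (h * g ^+ n * h^-1)^-1)%g.
    by rewrite !invgM invgK mulgA.
  rewrite /commg /conjg !invgK hgVh hghn invgM invgK !mulgA mulgVK -expgnDr.
  by rewrite mul2n addnn.
apply: (@scl_eq0 _ _ _ (2 * `|m - l|) 2) => [|n]; first by rewrite muln_gt0 absz_sub_gt0.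
rewrite -mulnA g2; apply: (is_comm_prodM (n := 1) (k := 1)).
  exact: is_comm_prod_commg.
exact: rotation_power_commutator zv.
Qed.

End Vanishing.

(** * Axes of hyperbolic elements *)

Section Axis.
Variables m l : int.
Hypotheses (m0 : m != 0) (l0 : l != 0).
Local Notation act := (@bs_act m l).
Local Notation adj := (@bs_adj m l).
Local Notation actM := (bs_actM m0 l0).
Local Notation act1 := (bs_act1 m0 l0).
Implicit Types (g h z : BS m l) (v : vertex m l) (b : bool) (i j k d e : int).

(** Take a vertex v whose geodesic to g v has minimal length L and join the
    translates of this geodesic.  A backtrack at g v would allow to shorten the
    geodesic at both ends.  The case L = 1 is excluded because g preserves heights
    while adjacent vertices have different heights. *)
Lemma axis_exists g : t_exponent g = 0 -> (forall v, act g v <> v) ->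
  exists (L : nat) (ax : int -> vertex m l),
  [/\ (0 < L)%N, forall i, adj (ax i) (ax (i + 1)),
      forall i, ax i != ax (i + 2)
    & forall i, act g (ax i) = ax (i + L%:Z)].
Proof.
move=> g0 gfree.
have ex : exists n, `[< exists v p, [/\ reduced adj (v :: p), last v p = act g v
                                     & size p = n] >].
  have [p red lE] := bs_connected (root m l) (act g (root m l)).
  by exists (size p); apply/asboolP; exists (root m l), p.
case: (ex_minnP ex) => L /asboolP[v [p [red lE pL]]] Lmin.
have adj_s r : (r < L)%N -> adj (nth v (v :: p) r) (nth v (v :: p) r.+1).
  by move=> rL; apply: reduced_nth_adj => //=; rewrite pL.
have neq_s r : (r.+1 < L)%N -> nth v (v :: p) r != nth v (v :: p) r.+2.
  by move=> rL; apply: (reduced_nth_neq v red); rewrite /= pL.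
have s0 : nth v (v :: p) 0 = v by [].
have sL : nth v (v :: p) L = act g v by rewrite -lE -pL -last_nth.
have L2 : (1 < L)%N.
  case: L pL sL adj_s {neq_s Lmin} => [|[|L]] // pL sL adj_s.
    by case: (gfree v); rewrite -sL s0.
  have := height_adj (adj_s 0%N isT); rewrite sL s0 height_act g0; lia.
(* Otherwise the walk without its first and last edge joins a vertex to its
   image under g. *)
have wrap : nth v (v :: p) L.-1 != act g (nth v (v :: p) 1).
  apply/eqP => E.
  case: p red lE pL E {adj_s neq_s s0 sL ex} => [|s1 p] red lE pL E.
    by rewrite -pL in L2.
  case/lastP: p red lE pL E => [|p w] red lE pL E; first by rewrite -pL in L2.
  suff : `[< exists v p, [/\ reduced adj (v :: p), last v p = act g v
                                     & size p = L.-2] >] by move/Lmin; lia.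
  apply/asboolP; exists s1, p; split.
  - apply: (@reduced_catl _ _ (@bs_adjC m l) _ [:: w]); rewrite cats1.
    exact: (@reduced_catr _ _ [:: v]).
  - rewrite /= size_rcons in pL; rewrite -pL /= in E.
    by rewrite -E -rcons_cons nth_rcons /= ltnSn -last_nth.
  - by rewrite -pL /= size_rcons.
move: (nth v (v :: p)) adj_s neq_s s0 sL wrap => s adj_s neq_s s0 sL wrap.
have L0 : (0 < L)%N by lia.
pose ax i := act (expgz g (i %/ L%:Z)%Z) (s `|(i %% L%:Z)%Z|%N).
have ax_lt q (r : nat) : (r < L)%N -> ax (q * L%:Z + r%:Z) = act (expgz g q) (s r).
  move=> rL; rewrite /ax divzMDl ?modzMDl; last lia.
  rewrite divz_small ?modz_small ?addr0 //; lia.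
have axE q (r : nat) : (r <= L)%N -> ax (q * L%:Z + r%:Z) = act (expgz g q) (s r).
  rewrite leq_eqVlt => /orP[/eqP ->|]; last exact: ax_lt.
  have -> : q * L%:Z + L%:Z = (q + 1) * L%:Z + 0%N%:Z by lia.
  by rewrite ax_lt // s0 sL -actM expgzD [expgz g 1]/=.
have split_i i : exists q (r : nat), (r < L)%N /\ i = q * L%:Z + r%:Z.
  exists (i %/ L%:Z)%Z, `|(i %% L%:Z)%Z|%N.
  have := @modz_ge0 i L%:Z; have := @ltz_pmod i L%:Z; have := divz_eq i L%:Z.
  by move=> E lt ge; split; lia.
exists L, ax; split=> //.
- move=> i; have [q [r [rL ->]]] := split_i i.
  have -> : q * L%:Z + r%:Z + 1 = q * L%:Z + r.+1%:Z by lia.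
  by rewrite !axE ?(ltnW rL) // bs_adj_act // adj_s.
- move=> i; have [q [r [rL ->]]] := split_i i.
  have inj g' : injective (act g') by apply: (act_inj actM act1).
  have [rL'|rL'] := ltnP r.+1 L.
    have -> : q * L%:Z + r%:Z + 2 = q * L%:Z + r.+2%:Z by lia.
    by rewrite !axE ?(ltnW rL) // (inj_eq (inj _)) neq_s.
  have -> : q * L%:Z + r%:Z + 2 = (q + 1) * L%:Z + 1%N%:Z by lia.
  rewrite !axE ?(ltnW rL) // expgzD actM (inj_eq (inj _)).
  by have -> : r = L.-1 by lia.
move=> i; have [q [r [rL ->]]] := split_i i.
have -> : q * L%:Z + r%:Z + L%:Z = (1 + q) * L%:Z + r%:Z by lia.
by rewrite !ax_lt // expgzD actM.
Qed.

End Axis.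

(** * Reversals of windows of an axis *)

Lemma max_periodic (f : int -> int) (L : nat) : (0 < L)%N ->
  (forall i, f (i + L%:Z) = f i) -> exists i, forall j, f j <= f i.
Proof.
move=> L0 fL.
have fLn n i : f (i + n%:Z * L%:Z) = f i.
  elim: n => [|n IHn]; first by rewrite mul0r addr0.
  by rewrite -IHn -[RHS]fL; congr f; lia.
have fLz k i : f (i + k * L%:Z) = f i.
  case: k => n; first exact: fLn.
  by rewrite -(fLn n.+1); congr f; lia.
case: L L0 fLz {fL fLn} => // L _ fLz.
exists ([arg max_(i > (ord0 : 'I_L.+1)) f (nat_of_ord i)]%O : 'I_L.+1)%N => j.
case: Order.TotalTheory.arg_maxP => // i _ iM.
have jL : (`|(j %% L.+1)%Z| < L.+1)%N by have := @ltz_pmod j L.+1 isT;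
  have := @modz_ge0 j L.+1 isT; lia.
have := iM (Ordinal jL) isT => /=; apply: le_trans.
rewrite {1}(divz_eq j L.+1) addrC fLz gez0_abs //; exact: modz_ge0.
Qed.

Lemma nearest_below (P : int -> Prop) (e i : int) : i <= e -> P i ->
  exists p, [/\ p <= e, P p & forall x, p < x -> x <= e -> ~ P x].
Proof.
move=> ie Pi; have ex : exists n : nat, `[< P (e - n%:Z) >].
  by exists `|e - i|%N; apply/asboolP; have -> : e - `|e - i|%N%:Z = i by lia.
case: (ex_minnP ex) => n /asboolP Pn nmin; exists (e - n%:Z); split=> //; first lia.
move=> x px xe Px; have := nmin `|e - x|%N.
have -> : e - `|e - x|%N%:Z = x by lia.
by move=> /(_ (introT (asboolP _) Px)); lia.
Qed.

Lemma nearest_above (P : int -> Prop) (e i : int) : e <= i -> P i ->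
  exists q, [/\ e <= q, P q & forall x, e <= x -> x < q -> ~ P x].
Proof.
move=> ie Pi; have [||p [pe Pp pmin]] := @nearest_below (fun x => P (- x)) (- e) (- i).
- lia.
- by rewrite opprK.
exists (- p); split=> //; first lia.
by move=> x ex xp Px; apply: (pmin (- x)); rewrite ?opprK //; lia.
Qed.

Section Reversal.
Variables m l : int.
Hypotheses (m0 : m != 0) (l0 : l != 0).
Local Notation act := (@bs_act m l).
Local Notation adj := (@bs_adj m l).
Local Notation actM := (bs_actM m0 l0).
Local Notation act1 := (bs_act1 m0 l0).
Implicit Types (h z : BS m l) (v : vertex m l) (b : bool) (i j k d e x y : int).

Variables (g : BS m l) (L : nat) (ax : int -> vertex m l).
Hypothesis g0 : t_exponent g = 0.
Hypothesis L0 : (0 < L)%N.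
Hypothesis ax_adj : forall i, adj (ax i) (ax (i + 1)).
Hypothesis ax_g : forall i, act g (ax i) = ax (i + L%:Z).

Let actKV := actKV actM act1.
Let actK := actK actM act1.

Definition axis_fixer z : Prop := forall x, act z (ax x) = ax x.

(** The edge i of the axis joins the vertices i and i + 1. *)
Definition edge_level i : int := edge_height (ax i) (ax (i + 1)).

Definition extreme b i : Prop :=
  if b then forall j, edge_level j <= edge_level i
  else forall j, edge_level i <= edge_level j.

Definition full i j : Prop := exists x y,
  [/\ i <= x <= j, i <= y <= j, extreme true x & extreme false y].

(** On positions of edges h acts as the reflection x |-> d - x, hence on positions
    of vertices as x |-> d + 1 - x. *)
Definition reverses h d i j : Prop :=
  forall x, i <= x <= j + 1 -> act h (ax x) = ax (d + 1 - x).

Lemma edge_level_g i : edge_level (i + L%:Z) = edge_level i.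
Proof.
have hE x : height (val (ax (x + L%:Z))) = height (val (ax x)).
  by rewrite -ax_g height_act g0 add0r.
by rewrite /edge_level /edge_height -addrA [L%:Z + 1]addrC addrA !hE.
Qed.

Lemma extreme_exists b : exists i, extreme b i.
Proof.
case: b; first exact: max_periodic L0 edge_level_g.
have [|i iM] := @max_periodic (fun i => - edge_level i) L L0.
  by move=> i; rewrite edge_level_g.
by exists i => j; rewrite -lerN2; apply: iM.
Qed.

Lemma edge_level_shift k i : edge_level (i + k * L%:Z) = edge_level i.
Proof.
have pos (n : nat) x : edge_level (x + n%:Z * L%:Z) = edge_level x.
  elim: n => [|n IHn]; first by rewrite mul0r addr0.
  by rewrite -IHn -[RHS]edge_level_g; congr edge_level; lia.
case: k => n; first exact: pos.
by rewrite -(pos n.+1); congr edge_level; lia.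
Qed.

Lemma extreme_shift b k i : extreme b i -> extreme b (i + k * L%:Z).
Proof. by case: b => /= ie j; rewrite edge_level_shift. Qed.

Lemma rotation_along z i q n :
  (forall j, i <= j -> j < i + n%:Z -> edge_lattice m l (edge_level j) q) ->
  rotation z (ax i) q -> rotation z (ax (i + n%:Z)) q.
Proof.
elim: n => [|n IHn] lat zi; first by rewrite addr0.
have -> : i + n.+1%:Z = i + n%:Z + 1 by lia.
apply: (rotation_extend m0 l0 (ax_adj _)).
  by apply: IHn => // j ij jn; apply: lat; lia.
by apply: lat; lia.
Qed.

(** The value of z lies in the lattices of an edge of maximal and of an edge of
    minimal level, hence in those of all edges of the axis, and z fixes the axis
    step by step. *)
Lemma full_axis_fixer z i j : full i j ->
  (forall x, i <= x <= j + 1 -> act z (ax x) = ax x) -> axis_fixer z.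
Proof.
move=> [x [y [xij yij xT yB]]] zfix.
have [q zi] := rotation_exists m0 l0 (zfix i ltac:(lia)).
have along (n : nat) : i + n%:Z <= j + 1 -> rotation z (ax (i + n%:Z)) q.
  elim: n => [|n IHn] nj; first by rewrite addr0.
  have := IHn ltac:(lia) => zn.
  have -> : i + n.+1%:Z = i + n%:Z + 1 by lia.
  apply: (rotation_extend m0 l0 (ax_adj _)) => //.
  by apply: (rotation_edge_lattice m0 l0 (ax_adj _) zn); apply: zfix; lia.
have lat_in k : i <= k <= j -> edge_lattice m l (edge_level k) q.
  move=> kij; have zk := along `|k - i|%N ltac:(lia).
  have E : i + `|k - i|%N%:Z = k by lia.
  rewrite E in zk; apply: (rotation_edge_lattice m0 l0 (ax_adj _) zk).
  by apply: zfix; lia.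
have lat k : edge_lattice m l (edge_level k) q.
  apply: (@edge_lattice_between _ _ m0 l0 (edge_level y) _ (edge_level x)).
  - by apply/andP; split; [apply: yB|apply: xT].
  - exact: lat_in.
  - exact: lat_in.
suff all k : rotation z (ax k) q by move=> k; apply: (rotation_fix m0 l0 (all k)).
have [ik|ki] := leP i k.
  have -> : k = i + `|k - i|%N%:Z by lia.
  exact: rotation_along.
have {ki} : exists n : nat, k = i - n%:Z by exists `|k - i|%N; lia.
move=> [n ->]; elim: n => [|n IHn]; first by rewrite subr0.
apply: (rotation_extend m0 l0 _ IHn).
  rewrite bs_adjC; have := ax_adj (i - n.+1%:Z); congr (adj _ (ax _)); lia.
rewrite edge_heightC; have := lat (i - n.+1%:Z); rewrite /edge_level.
by have -> : i - n.+1%:Z + 1 = i - n%:Z by lia.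
Qed.

(** g shifts the axis and preserves heights, so z and its conjugate by g have the
    same value at the vertex L. *)
Lemma axis_fixer_commute z : axis_fixer z -> commute g z.
Proof.
clear L0.
move=> zfix; have [q z_0] := rotation_exists m0 l0 (zfix 0).
have zL : rotation z (ax (0 + L%:Z)) q.
  have all (n : nat) : rotation z (ax (0 + n%:Z)) q.
    elim: n => [|n IHn] //; have -> : 0 + n.+1%:Z = 0 + n%:Z + 1 by lia.
    apply: (rotation_extend m0 l0 (ax_adj _)) => //.
    exact: (rotation_edge_lattice m0 l0 (ax_adj _) IHn).
  exact: all.
have := rotation_conj m0 l0 g0 z_0; rewrite ax_g => zL'.
by have := rotation_inj m0 l0 zL zL'; rewrite /commute => {2}->; rewrite mulgVK.
Qed.

Lemma reverses_shift h d i j k : reverses h d i j ->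
  reverses (expgz g k * h)%g (d + k * L%:Z) i j.
Proof.
have gk x : act (expgz g k) (ax x) = ax (x + k * L%:Z).
  have pos (n : nat) y : act (g ^+ n)%g (ax y) = ax (y + n%:Z * L%:Z).
    by rewrite (ax_gX actM act1 ax_g); congr ax; lia.
  case: k => n; first exact: pos.
  rewrite -[in LHS](subrK (n.+1%:Z * L%:Z) x) -(pos n.+1) -actM mulVg act1.
  by congr ax; lia.
by move=> hE x xij; rewrite actM hE // gk; congr ax; lia.
Qed.

Section Reversing.
Variables (h : BS m l) (d e : int).
Hypothesis hE : reverses h d e (e + L%:Z).

(** A window of length L contains all levels.  The change of level caused by h
    therefore vanishes, by comparison at the maximum and at the minimum. *)
Lemma reverses_level x : edge_level (d - x) = edge_level x.
Proof.
have step y : e <= y <= e + L%:Z -> edge_level (d - y) = edge_level y + t_exponent h.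
  move=> ye; rewrite /edge_level edge_heightC.
  have -> : d - y + 1 = d + 1 - y by lia.
  have -> : d - y = d + 1 - (y + 1) by lia.
  rewrite -!hE; [|lia|lia].
  by rewrite /edge_height !height_act lerD2l; case: ifP; lia.
have all y : edge_level (d - y) = edge_level y + t_exponent h.
  have := divz_eq (y - e) L%:Z; have := @modz_ge0 (y - e) L%:Z.
  have := @ltz_pmod (y - e) L%:Z.
  move: ((y - e) %/ L%:Z)%Z ((y - e) %% L%:Z)%Z => k r lt ge E.
  have -> : y = (e + r) + k * L%:Z by lia.
  rewrite edge_level_shift -step; last by lia.
  by rewrite -[RHS](edge_level_shift (- k)); congr edge_level; lia.
have [i iM] := extreme_exists true; have [j jm] := extreme_exists false.
have := all i; have := iM (d - i); have := all j; have := jm (d - j).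
move=> h1 h2 h3 h4; rewrite all; lia.
Qed.

Lemma reverses_extreme b x : extreme b x -> extreme b (d - x).
Proof. by case: b => /= xe y; rewrite reverses_level. Qed.

Lemma reverses_full i j : full i j -> full (d - j) (d - i).
Proof.
move=> [x [y [xij yij xT yB]]]; exists (d - x), (d - y).
by split; [lia|lia|apply: reverses_extreme|apply: reverses_extreme].
Qed.

End Reversing.

Definition axis_inverted : Prop := exists h, axis_fixer (g * h * g * h^-1)%g.

Lemma axis_fixerM z z' : axis_fixer z -> axis_fixer z' -> axis_fixer (z * z')%g.
Proof. by move=> zf zf' x; rewrite actM zf' zf. Qed.

Lemma axis_fixerV z : axis_fixer z -> axis_fixer z^-1%g.
Proof. by move=> zf x; rewrite -{1}(zf x) actK. Qed.

(** The squares of h and of g h fix the segments [e, d - e] and [d - e, e + L], so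
    they fix the axis; and g h g h^-1 is the square of g h divided by that of h. *)
Lemma inverted_of_involutions h d e : reverses h d e (e + L%:Z) ->
  2 * e <= d <= 2 * e + L%:Z -> full e (d - e) -> full (d - e) (e + L%:Z) ->
  axis_inverted.
Proof.
move=> hE de f1 f2; exists h.
have h2 : axis_fixer (h * h)%g.
  apply: (full_axis_fixer f1) => x xe; rewrite actM !hE; try lia.
  by congr ax; lia.
have gh2 : axis_fixer (g * h * (g * h))%g.
  apply: (full_axis_fixer f2) => x xe; rewrite !actM hE; last lia.
  rewrite ax_g hE; last lia.
  by rewrite ax_g; congr ax; lia.
have -> : (g * h * g * h^-1 = g * h * (g * h) * (h * h)^-1)%g.
  by rewrite invgM !mulgA mulgK.
by apply: axis_fixerM => //; apply: axis_fixerV.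
Qed.

(** Powers of g shift d by multiples of L. *)
Lemma window_normalized e : (exists h d, reverses h d e (e + L%:Z)) ->
  exists h d, reverses h d e (e + L%:Z) /\ 2 * e <= d < 2 * e + L%:Z.
Proof.
move=> [h [d hE]].
exists (expgz g (- ((d - 2 * e) %/ L%:Z)%Z) * h)%g.
exists (d + (- ((d - 2 * e) %/ L%:Z)%Z) * L%:Z).
have := divz_eq (d - 2 * e) L%:Z; have := @modz_ge0 (d - 2 * e) L%:Z.
have := @ltz_pmod (d - 2 * e) L%:Z => lt ge E.
by split; [apply: reverses_shift|lia].
Qed.

(** Here p and q are the extreme edges of the other kind next to e.  If one of the
    segments in [inverted_of_involutions] is not full, e and its mirror image lie in
    the same gap between p and q up to a translation by L, and the reflection
    exchanges the ends of this gap. *)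
Lemma window_center b e (p q : int) : extreme b e -> p < e -> e < q ->
  extreme (~~ b) p -> extreme (~~ b) q ->
  (forall x, p < x -> x < q -> ~ extreme (~~ b) x) ->
  (exists h d, reverses h d e (e + L%:Z)) ->
  axis_inverted \/ exists h, reverses h (p + q) e (e + L%:Z).
Proof.
move=> eb pe eq pb qb pq [h' [d' h'E]].
have [h [d [hE /andP[dlo dhi]]]] := window_normalized (ex_intro _ h' (ex_intro _ d' h'E)).
have refl D : (forall x, extreme (~~ b) x -> extreme (~~ b) (D - x)) ->
    p < D - e < q -> D = p + q.
  move=> Dr De.
  have := pq _ _ _ (Dr _ pb); have := pq _ _ _ (Dr _ qb).
  have [|] := ltP p (D - q); have [|] := ltP (D - p) q; lia.
have eT : extreme b (e + L%:Z) by have := extreme_shift 1 eb; rewrite mul1r.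
have dr x : extreme (~~ b) x -> extreme (~~ b) (d - x) by apply: reverses_extreme hE _ _.
have mk_full i j x y : i <= x <= j -> i <= y <= j -> extreme b x ->
    extreme (~~ b) y -> full i j.
  by move=> xij yij xb yb; case: (b) xb yb => xb yb; [exists x, y|exists y, x].
have [f1|nf1] := pselect (full e (d - e)); last first.
  right; exists h; rewrite -(refl d) //.
  apply/andP; split; first lia.
  rewrite ltNge; apply/negP => qd; apply: nf1; apply: (mk_full _ _ e q) => //; lia.
have [f2|nf2] := pselect (full (d - e) (e + L%:Z)).
  by left; apply: inverted_of_involutions hE _ f1 f2; lia.
right; exists (expgz g (-1) * h)%g.
have dE : d + (-1) * L%:Z = p + q.
  apply: refl => [x xb|].
    have := extreme_shift (-1) (dr x xb); congr extreme; lia.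
  apply/andP; split; last lia.
  rewrite ltNge; apply/negP => dp; apply: nf2.
  apply: (mk_full _ _ (e + L%:Z) (p + L%:Z)) => //; try lia.
  by have := extreme_shift 1 pb; rewrite mul1r.
by rewrite -dE; apply: reverses_shift.
Qed.

Theorem axis_inverted_of_reversals :
  (forall e, exists h d, reverses h d e (e + L%:Z)) -> axis_inverted.
Proof.
move=> rev; apply: contrapT => ninv.
(* An edge of both kinds makes all segments containing it full. *)
have disj b x : extreme b x -> ~ extreme (~~ b) x.
  move=> xb xnb; apply: ninv; have [h [d [hE dx]]] := window_normalized (rev x).
  have fullx i j : i <= x <= j -> full i j.
    by move=> xij; exists x, x; split=> //; case: b xb xnb.
  have full_end i : i <= x + L%:Z -> full i (x + L%:Z).
    move=> ix; exists (x + 1 * L%:Z), (x + 1 * L%:Z).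
    split; [lia|lia|apply: extreme_shift|apply: extreme_shift];
      by case: b xb xnb.
  apply: (inverted_of_involutions hE); [lia|apply: fullx; lia|apply: full_end; lia].
have center b e p q : extreme b e -> p < e -> e < q ->
    extreme (~~ b) p -> extreme (~~ b) q ->
    (forall x, p < x -> x < q -> ~ extreme (~~ b) x) ->
    exists h, reverses h (p + q) e (e + L%:Z).
  by move=> eb pe eq pb qb pq; case: (window_center eb pe eq pb qb pq (rev e)).
have gap b e : extreme b e -> exists p q, [/\ p < e < q, extreme (~~ b) p,
    extreme (~~ b) q & forall x, p < x -> x < q -> ~ extreme (~~ b) x].
  move=> eb; have [i ib] := extreme_exists (~~ b).
  have [p [pe pb pmin]] : exists p, [/\ p <= e, extreme (~~ b) p
      & forall x, p < x -> x <= e -> ~ extreme (~~ b) x].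
    apply: (@nearest_below _ e (i + (- `|i - e|%N%:Z) * L%:Z)).
      nia.
    exact: extreme_shift.
  have [q [qe qb qmin]] : exists q, [/\ e <= q, extreme (~~ b) q
      & forall x, e <= x -> x < q -> ~ extreme (~~ b) x].
    apply: (@nearest_above _ e (i + `|i - e|%N%:Z * L%:Z)).
      nia.
    exact: extreme_shift.
  have ne x : extreme (~~ b) x -> x != e.
    by move=> xb; apply/eqP => xe; apply: (disj b e) => //; rewrite -xe.
  have := ne _ pb; have := ne _ qb => ? ?.
  exists p, q; split=> //; first by lia.
  move=> x px xq; have [xe|ex] := leP x e; first exact: pmin.
  by apply: qmin => //; lia.
(* The run of the edge e is centred at (p + q) / 2; the edge f is the last extreme
   edge before the opposite centre D / 2. *)
have [e eT] := extreme_exists true.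
have [p [q [/andP[pe eq] pB qB pq]]] := gap true e eT.
have [h' h'E] := center true e p q eT pe eq pB qB pq.
set D := p + q + L%:Z.
have [h hE] : exists h, reverses h D e (e + L%:Z).
  exists (expgz g 1 * h')%g; have := reverses_shift 1 h'E.
  by rewrite /D mul1r.
have qpL : q <= p + L%:Z.
  rewrite leNgt; apply/negP => pLq; apply: (pq (p + L%:Z)) => //; first lia.
  by have := extreme_shift 1 pB; rewrite mul1r.
have Dr b x : extreme b x -> extreme b (D - x) by apply: reverses_extreme hE _ _.
have [f [fD [b fb] fmax]] : exists f, [/\ f <= (D %/ 2)%Z, exists b, extreme b f
    & forall x, f < x -> x <= (D %/ 2)%Z -> ~ exists b, extreme b x].
  apply: (@nearest_below (fun x => exists b, extreme b x) _ q); last by exists false.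
  by rewrite /D; lia.
have qf : q <= f.
  rewrite leNgt; apply/negP => fq; apply: (fmax q) => //; last by exists false.
  by rewrite /D; lia.
have none x : f < x -> x < D - f -> ~ exists b, extreme b x.
  move=> fx xf; have [xD|Dx] := leP x (D %/ 2)%Z; first exact: fmax.
  move=> [b' xb']; apply: (fmax (D - x)); [lia|lia|].
  by exists b'; apply: Dr.
have [p' [q' [/andP[pf fq] p'b q'b pq']]] := gap b f fb.
have f'b := Dr _ _ fb.
have q'f : D - f < q'.
  rewrite ltNge; apply/negP => q'le.
  have [q'E|q'ne] := eqVneq q' (D - f); first by apply: (disj b q') => //; rewrite q'E.
  by apply: (none q'); [lia|lia|exists (~~ b)].
(* The run of f contains f and its mirror image D - f. *)
have DE : p' + q' = D.
  have := pq' _ _ _ (Dr _ _ p'b); have := pq' _ _ _ (Dr _ _ q'b).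
  have [|] := ltP p' (D - q'); have [|] := ltP (D - p') q'; lia.
have [hf hfE] := center b f p' q' fb pf fq p'b q'b pq'.
rewrite DE in hfE.
have fpL : f <= p + L%:Z by move: fD; rewrite /D; lia.
(* Both h and hf act as the reflection D on the full segment [f, e + L]. *)
have hhf : axis_fixer (h^-1 * hf)%g.
  apply: (@full_axis_fixer _ f (e + L%:Z)).
    exists (e + L%:Z), (p + L%:Z); split; [lia|lia| |].
      by have := extreme_shift 1 eT; rewrite mul1r.
    by have := extreme_shift 1 pB; rewrite mul1r.
  move=> x xf; rewrite actM hfE; last lia.
  by rewrite -hE; [rewrite actK|lia].
have hE' : reverses h D e (f + L%:Z).
  move=> x xe; have [xL|Lx] := leP x (e + L%:Z + 1); first by apply: hE; lia.
  by rewrite -hfE; [rewrite -{1}(hhf x) actM actKV|lia].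
apply: ninv; exists h; apply: (@full_axis_fixer _ (D - f) (D - e)).
  apply: (reverses_full hE); exists e, q.
  by split; [lia|lia| |].
move=> y ye; have -> : y = D + 1 - (D + 1 - y) by lia.
set x := D + 1 - y; rewrite -(hE' x); last by rewrite /x; lia.
rewrite !actM actK ax_g hE'; last by rewrite /x; lia.
rewrite hE'; last by rewrite /x; lia.
by rewrite ax_g; congr ax; lia.
Qed.

End Reversal.

(** * The gap theorem *)

Unset Implicit Arguments.

Theorem theorem7p8 (R : realType) (m l : int)
  (hm : m != 0) (hl : l != 0) (hml : m != l) (g : BS m l) :
  scl R g = 0%:E \/ ((1 / 12 : R)%:E <= scl R g)%E.
Proof.
have [g0|g0] := eqVneq (t_exponent g) 0; last first.
  right; apply: (@scl_ge _ _ _ 12) => // n k /(t_exponent_comm_prod hm hl) /eqP.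
  by rewrite (t_exponentX hm hl) mulf_eq0 (negPf g0) /= => /eqP [->].
have [[v gv]|gfree] := pselect (exists v, bs_act g v = v).
  by left; apply: (scl_elliptic R hm hl hml gv).
have [L [ax [L0 ax_adj ax_nobt ax_g]]] := axis_exists hm hl g0
  (fun v gv => gfree (ex_intro _ v gv)).
have [[e wa]|nwa] := pselect (exists e, forall h d, ~ reverses ax h d e (e + L%:Z)).
  right; apply: scl_ge => //.
  apply: (well_aligned_bound (bs_actM hm hl) (bs_act1 hm hl) (@bs_adjC m l)
    (bs_adj_act hm hl) (@bs_no_closed_walk m l) (@bs_connected m l)
    L0 ax_adj ax_nobt ax_g (e := e)) => h d hE.
  apply: (wa h (d + e - 1)) => x xe.
  have := hE `|x - e|%N; have -> : e + `|x - e|%N%:Z = x by lia.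
  by move=> ->; [congr ax; lia|lia].
left; have [|h hfix] := axis_inverted_of_reversals hm hl g0 L0 ax_adj ax_g.
  move=> e; apply: contrapT => nrev; apply: nwa; exists e => h d hE.
  by apply: nrev; exists h, d.
apply: (scl_inverted R hm hl hml _ (hfix 0)).
exact: (axis_fixer_commute hm hl g0 ax_adj ax_g hfix).
Qed.
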